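(* Let $K=\mathbf{C}$, $n\ge 2$, $D=\frac{(n-1)(n-2)}{2}$, and let $\mathcal{N}$ be the variety of nilpotent $n\times n$ matrices over $K$ with the conjugation action of the group $U$ of upper-triangular matrices with all diagonal entries $1$. Let $\mathcal{N}/\!\!/U=\mathrm{Spec}\,K[\mathcal{N}]^U$, let $K[\mathcal{N}]^U_{\mathrm{tor}}\subseteq K[\mathcal{N}]^U$ be the subring generated by all toric invariants, let $X=\mathrm{Spec}\,K[\mathcal{N}]^U_{\mathrm{tor}}$ be the associated toric variety, and let $X'\cong(K^* )^{n-1}$ be the dense torus orbit in $X$. Then the natural embedding $K[\mathcal{N}]^U_{\mathrm{tor}}\to K[\mathcal{N}]^U$ induces a dominant, $T$-equivariant morphism $p\colon\mathcal{N}/\!\!/U\to X$ such that $p^{-1}(x')\cong\mathbf{A}^D$ for each point $x'\in X'$.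
   Context: For a matrix $M\in K^{n\times n}$, $M_{(a,b)}$ denotes the submatrix formed by the last $a$ rows and the first $b$ columns. A datum $\mathcal{P}=((a_i)_i,(a'_j)_j,(\mathcal{P}_{i,j})_{i,j})$ consists of positive integers $s,t$, integers $a_1,\dots,a_s,a'_1,\dots,a'_t\in\{1,\dots,n\}$ with $a_1+\dots+a_s=a'_1+\dots+a'_t=:r$, and polynomials $\mathcal{P}_{i,j}\in K[x]$; it defines the $U$-invariant function $f^{\mathcal{P}}(N)=\det\left(\mathcal{P}_{i,j}(N)_{(a_i,a'_j)}\right)_{i,j}$ on $\mathcal{N}$ (determinant of an $r\times r$ block matrix). Let $\mathcal{H}_U=\{H\in\mathcal{N}\mid H_{i,j}=0 \text{ for } i\le j,\ H_{i+1,i}\ne0 \text{ for all } i\}$. For $H\in\mathcal{H}_U$ put $x_i:=H_{i+1,i}$ and let the toric part $H_{\mathrm{tor}}$ have entries $(H_{\mathrm{tor}})_{j+1,j}=x_j$ and all other entries $0$. An invariant $f=f^{\mathcal{P}}$ is toric if $f(H)=f(H_{\mathrm{tor}})$ for all $H\in\mathcal{H}_U$. Every toric invariant restricts on $\mathcal{H}_U$ to a scalar multiple of a monomial $x_1^{h_1}\cdots x_{n-1}^{h_{n-1}}$, and $K[\mathcal{N}]^U_{\mathrm{tor}}$ is finitely generated; $X$ is a toric variety, with $(K^* )^{n-1}$ acting on $K[\mathcal{N}]^U_{\mathrm{tor}}$ by sending a toric invariant $f$ with $f(H)=x_1^{h_1}\cdots x_{n-1}^{h_{n-1}}$ to $c_1^{h_1}\cdots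 c_{n-1}^{h_{n-1}}f$ for $c=(c_1,\dots,c_{n-1})$. $T\subset\mathrm{GL}_n(K)$ is the torus of diagonal matrices. It acts on $K[\mathcal{N}]^U$, hence on $\mathcal{N}/\!\!/U$, via $(t,f)\mapsto\big(N\mapsto f(tNt^{-1})\big)$, and on $K[\mathcal{N}]^U_{\mathrm{tor}}$, hence on $X$, via the homomorphism $T\to(K^* )^{n-1}$, $(t_1,\dots,t_n)\mapsto(t_2/t_1,\dots,t_n/t_{n-1})$, and the action of $(K^* )^{n-1}$ on $K[\mathcal{N}]^U_{\mathrm{tor}}$ under which $c=(c_1,\dots,c_{n-1})$ sends a toric invariant $f$ with $f(H)=x_1^{h_1}\cdots x_{n-1}^{h_{n-1}}$ for $H\in\mathcal{H}_U$ to $c_1^{h_1}\cdots c_{n-1}^{h_{n-1}}f$. *)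

(* Defs.v *)
From HB Require Import structures.
From mathcomp Require Import all_boot all_order all_algebra.
From mathcomp Require Import boolp classical_sets functions.
From mathcomp Require Import mpoly.

Set Implicit Arguments.
Unset Strict Implicit.
Unset Printing Implicit Defensive.

Import GRing.Theory.
Local Open Scope ring_scope.
Local Open Scope classical_set_scope.

(** * The nilpotent cone and its coordinate ring *)

Section NilpotentCone.
Variables (K : fieldType) (n : nat).

Definition is_nilp (M : 'M[K]_n) : bool := `[< exists k : nat, M ^+ k = 0 >].

Definition nilp : Type := {M : 'M[K]_n | is_nilp M}.
HB.instance Definition _ := Choice.on nilp.

Lemma is_nilp0 : is_nilp 0.
Proof. by apply/asboolP; exists 1%N; rewrite expr1. Qed.

HB.instance Definition _ := isPointed.Build nilp (Sub 0 is_nilp0 : nilp).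

Lemma conjX (g M : 'M[K]_n) (k : nat) : g \in unitmx ->
  (g *m M *m invmx g) ^+ k = g *m (M ^+ k) *m invmx g.
Proof.
move=> gU; elim: k => [|k IHk]; first by rewrite !expr0 mulmx1 mulmxV.
by rewrite !exprS IHk -!mulmxE !mulmxA mulmxKV.
Qed.

Lemma is_nilp_conj (g M : 'M[K]_n) :
  g \in unitmx -> is_nilp M -> is_nilp (g *m M *m invmx g).
Proof.
move=> gU /asboolP[k Mk]; apply/asboolP; exists k.
by rewrite conjX // Mk mulmx0 mul0mx.
Qed.

Definition nilp_conj (g : 'M[K]_n) (gU : g \in unitmx) (N : nilp) : nilp :=
  Sub (g *m val N *m invmx g) (is_nilp_conj gU (valP N)).

Definition nfun : Type := nilp -> K.
HB.instance Definition _ := GRing.ComNzRing.copy nfun (nilp -> K).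
HB.instance Definition _ := GRing.Lmodule.copy nfun (nilp -> K^o).

Lemma nfun_scalerAl (c : K) (f g : nfun) : c *: (f * g) = c *: f * g.
Proof. by apply/funext => N; exact: mulrA. Qed.
HB.instance Definition _ := GRing.Lmodule_isLalgebra.Build K nfun nfun_scalerAl.
HB.instance Definition _ := GRing.Lalgebra_isComAlgebra.Build K nfun.

(* K[N] as functions: N is a variety, i.e. reduced, so over an algebraically
   closed field a regular function is determined by its values. *)
Definition regular (f : nfun) : Prop :=
  exists P : {mpoly K[n * n]},
    forall N : nilp, f N = P.@[fun k => mxvec (val N) 0 k].

Definition unitriangular (u : 'M[K]_n) : Prop :=
  (forall i j : 'I_n, (j < i)%N -> u i j = 0) /\ (forall i, u i i = 1).

Definition U_invariant (f : nfun) : Prop :=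
  forall (u : 'M[K]_n) (uU : u \in unitmx), unitriangular u ->
    forall N : nilp, f (nilp_conj uU N) = f N.

Definition inv_pred : {pred nfun} :=
  fun f => `[< regular f /\ U_invariant f >].

Lemma inv_predP f : reflect (regular f /\ U_invariant f) (f \in inv_pred).
Proof. exact: asboolP. Qed.

Lemma inv_subalg_closed : GRing.subalg_closed inv_pred.
Proof.
split.
- apply/inv_predP; split; last by [].
  by exists 1 => N; rewrite meval1.
- move=> c f g /inv_predP[[P hP] hf] /inv_predP[[Q hQ] hg].
  apply/inv_predP; split.
    by exists (c *: P + Q) => N; rewrite mevalD mevalZ -hP -hQ.
  by move=> u uU uT N; rewrite -[LHS]/(c * f _ + g _) hf // hg.
- move=> f g /inv_predP[[P hP] hf] /inv_predP[[Q hQ] hg].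
  apply/inv_predP; split.
    by exists (P * Q) => N; rewrite mevalM -hP -hQ.
  by move=> u uU uT N; rewrite -[LHS]/(f _ * g _) hf // hg.
Qed.
HB.instance Definition _ := GRing.isSubalgClosed.Build K nfun inv_pred
  inv_subalg_closed.

(* K[N]^U *)
Record inv_ring := InvRing { inv_fun : nfun; _ : inv_fun \in inv_pred }.
HB.instance Definition _ := [isSub for inv_fun].
HB.instance Definition _ := [Choice of inv_ring by <:].
HB.instance Definition _ := [SubChoice_isSubComNzRing of inv_ring by <:].
HB.instance Definition _ := [SubZmodule_isSubLmodule of inv_ring by <:].
HB.instance Definition _ := [SubNzRing_SubLmodule_isSubLalgebra of inv_ring by <:].
HB.instance Definition _ := GRing.Lalgebra_isComAlgebra.Build K inv_ring.
End NilpotentCone.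

(** * The torus action on K[N]^U *)

Section Torus.
Variables (K : fieldType) (m : nat).

Definition torus : Type := {c : 'rV[K]_m | [forall i, c 0 i != 0]}.

Definition tcoord (c : torus) (i : 'I_m) : K := val c 0 i.

Lemma tcoord_neq0 c i : tcoord c i != 0.
Proof. exact: (forallP (valP c) i). Qed.

Lemma mktorus_subproof (a : 'I_m -> K) : (forall i, a i != 0) ->
  [forall i, (\row_j a j) 0 i != 0].
Proof. by move=> a0; apply/forallP => i; rewrite mxE. Qed.

Definition mktorus (a : 'I_m -> K) (a0 : forall i, a i != 0) : torus :=
  Sub (\row_j a j) (mktorus_subproof a0).

Definition torus1 : torus := mktorus (fun=> oner_neq0 K).

Lemma torus_mul_subproof (c d : torus) i : tcoord c i * tcoord d i != 0.
Proof. by rewrite mulf_neq0 ?tcoord_neq0. Qed.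

Definition torus_mul (c d : torus) : torus := mktorus (torus_mul_subproof c d).

Definition tdiag (t : torus) : 'M[K]_m := diag_mx (val t).

Lemma tdiag_unit t : tdiag t \in unitmx.
Proof.
by rewrite unitmxE det_diag unitfE; apply/prodf_neq0 => i _; exact: tcoord_neq0.
Qed.

End Torus.

Section DiagonalAction.
Variables (K : fieldType) (n : nat).
Implicit Types (t : torus K n) (f : inv_ring K n).

Lemma tdiag_conjE t (M : 'M[K]_n) i j :
  (tdiag t *m M *m invmx (tdiag t)) i j = tcoord t i * M i j / tcoord t j.
Proof.
have -> : invmx (tdiag t) = diag_mx (\row_j (tcoord t j)^-1).
  suff E : tdiag t *m diag_mx (\row_j (tcoord t j)^-1) = 1%:M.
    by rewrite -[RHS](mulKmx (tdiag_unit t)) E mulmx1.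
  rewrite mulmx_diag -diag_const_mx; congr diag_mx; apply/rowP => k.
  by rewrite !mxE divff // tcoord_neq0.
by rewrite mul_mx_diag mul_diag_mx !mxE.
Qed.

Definition tact_fun t f : nfun K n := 
  fun N => inv_fun f (nilp_conj (tdiag_unit t) N).

Lemma tact_subproof t f : tact_fun t f \in @inv_pred K n.
Proof.
have /inv_predP[[P hP] hf] := valP f; apply/inv_predP; split.
  pose a := mxvec (\matrix_(i, j) (tcoord t i / tcoord t j)).
  exists (P \mPo [tuple a 0 k *: 'X_k | k < n * n]) => N.
  rewrite comp_mpoly_meval [LHS]hP; apply: meval_eq => k.
  rewrite tnth_mktuple mevalZ mevalXU.
  case/mxvec_indexP: k => i j; rewrite !mxvecE tdiag_conjE mxE.
  by rewrite mulrAC.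
move=> u uU [u0 u1] N; rewrite /tact_fun.
pose g := tdiag t; have gU : g \in unitmx := tdiag_unit t.
pose v := g *m u *m invmx g.
have vU : v \in unitmx by rewrite !unitmx_mul gU uU unitmx_inv gU.
have vT : unitriangular v.
  split=> [i j ji|i]; rewrite tdiag_conjE; first by rewrite u0 // mulr0 mul0r.
  by rewrite u1 mulr1 divff ?tcoord_neq0.
rewrite -[RHS](hf v vU vT); congr (inv_fun f _); apply: val_inj => /=.
have -> : invmx v = g *m invmx u *m invmx g.
  rewrite -[RHS](mulKmx vU) /v -!mulmxA (mulKmx gU) (mulKVmx uU).
  by rewrite mulmxV // mulmx1.
by rewrite /v -/g -!mulmxA (mulKmx gU) (mulKmx gU).
Qed.

(* (t, f) |-> (N |-> f (t N t^-1)) *)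
Definition tact t f : inv_ring K n := InvRing (tact_subproof t f).

Lemma tact_zmod_morphism t : zmod_morphism (tact t).
Proof. by move=> f g; apply: val_inj. Qed.
Lemma tact_monoid_morphism t : monoid_morphism (tact t).
Proof. by split=> [|f g]; apply: val_inj. Qed.
Lemma tact_scalable t : scalable (tact t).
Proof. by move=> c f; apply: val_inj. Qed.
HB.instance Definition _ t :=
  GRing.isZmodMorphism.Build _ _ (tact t) (tact_zmod_morphism t).
HB.instance Definition _ t :=
  GRing.isMonoidMorphism.Build _ _ (tact t) (tact_monoid_morphism t).
HB.instance Definition _ t :=
  GRing.isScalable.Build K _ _ _ (tact t) (tact_scalable t).

End DiagonalAction.

(** * Toric invariants *)

Section ToricInvariants.
Variables (K : fieldType) (n : nat).

Definition corner (a b : nat) (an : (a <= n)%N) (bn : (b <= n)%N)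
    (M : 'M[K]_n) : 'M[K]_(a, b) :=
  \matrix_(i < a, j < b) M (rev_ord (widen_ord an (rev_ord i))) (widen_ord bn j).

(* [horner_mx] is only available for matrices of size [_.+1]. *)
Definition polymx (P : {poly K}) (M : 'M[K]_n) : 'M[K]_n :=
  \sum_(i < size P) P`_i *: M ^+ i.

Record datum := Datum {
  ds : nat;
  dt : nat;
  ds_gt0 : (0 < ds)%N;
  dt_gt0 : (0 < dt)%N;
  da : 'I_ds -> nat;
  da' : 'I_dt -> nat;
  da_gt0 : forall i, (0 < da i)%N;
  da_le : forall i, (da i <= n)%N;
  da'_gt0 : forall j, (0 < da' j)%N;
  da'_le : forall j, (da' j <= n)%N;
  da_sum : (\sum_i da i = \sum_j da' j)%N;
  dP : 'I_ds -> 'I_dt -> {poly K}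
}.

Arguments da : clear implicits.
Arguments da' : clear implicits.
Arguments da_le : clear implicits.
Arguments da'_le : clear implicits.
Arguments dP : clear implicits.

Definition blockmx (P : datum) (M : 'M[K]_n) :
    'M[K]_(\sum_i da P i, \sum_j da' P j) :=
  \mxblock_(i, j) corner (da_le P i) (da'_le P j) (polymx (dP P i j) M).

Definition datum_fun (P : datum) (M : 'M[K]_n) : K :=
  \det (castmx (erefl, esym (da_sum P)) (blockmx P M)).

Definition sub_lo (i : 'I_n.-1) : 'I_n := widen_ord (leq_pred n) i.

Lemma sub_hi_subproof (i : 'I_n.-1) : (i.+1 < n)%N.
Proof. by rewrite -ltn_predRL. Qed.

Definition sub_hi (i : 'I_n.-1) : 'I_n := Ordinal (sub_hi_subproof i).

Definition subdiag (H : 'M[K]_n) (i : 'I_n.-1) : K := H (sub_hi i) (sub_lo i).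

(* H_U; strictly lower triangular matrices are automatically nilpotent. *)
Definition in_HU (H : 'M[K]_n) : Prop :=
  (forall i j : 'I_n, (i <= j)%N -> H i j = 0) /\
  (forall i : 'I_n.-1, subdiag H i != 0).

Definition toric_part (H : 'M[K]_n) : 'M[K]_n :=
  \matrix_(i, j) if (i == j.+1 :> nat) then H i j else 0.

Definition is_toric (P : datum) : Prop :=
  forall H, in_HU H -> datum_fun P H = datum_fun P (toric_part H).

Definition toric_invariant (f : inv_ring K n) : Prop :=
  exists2 P : datum, is_toric P & forall N, inv_fun f N = datum_fun P (val N).

(* K[N]^U_tor. Subring and K-subalgebra generated agree here: the data with
   s = t = 1, a_1 = a'_1 = n and constant P_{1,1} = c are toric, with value
   c ^ n, hence over an algebraically closed field all constants are toric. *)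
Definition tor_pred : {pred inv_ring K n} :=
  fun f => `[< forall S : {pred inv_ring K n}, GRing.subalg_closed S ->
    (forall g, toric_invariant g -> g \in S) -> f \in S >].

Lemma tor_subalg_closed : GRing.subalg_closed tor_pred.
Proof.
split.
- by apply/asboolP => S [].
- move=> c f g /asboolP hf /asboolP hg; apply/asboolP => S hS hT.
  by have [_ + _] := hS; apply; [exact: hf|exact: hg].
- move=> f g /asboolP hf /asboolP hg; apply/asboolP => S hS hT.
  by have [_ _ +] := hS; apply; [exact: hf|exact: hg].
Qed.
HB.instance Definition _ := GRing.isSubalgClosed.Build K (inv_ring K n) tor_pred
  tor_subalg_closed.

Record tor_ring := TorRing { tor_val : inv_ring K n; _ : tor_val \in tor_pred }.
HB.instance Definition _ := [isSub for tor_val].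
HB.instance Definition _ := [Choice of tor_ring by <:].
HB.instance Definition _ := [SubChoice_isSubComNzRing of tor_ring by <:].
HB.instance Definition _ := [SubZmodule_isSubLmodule of tor_ring by <:].
HB.instance Definition _ := [SubNzRing_SubLmodule_isSubLalgebra of tor_ring by <:].
HB.instance Definition _ := GRing.Lalgebra_isComAlgebra.Build K tor_ring.

Lemma tor_val_zmod_morphism : zmod_morphism tor_val.
Proof. by []. Qed.
Lemma tor_val_monoid_morphism : monoid_morphism tor_val.
Proof. by []. Qed.
Lemma tor_val_scalable : scalable tor_val.
Proof. by []. Qed.
HB.instance Definition _ :=
  GRing.isZmodMorphism.Build tor_ring (inv_ring K n) tor_val tor_val_zmod_morphism.
HB.instance Definition _ :=
  GRing.isMonoidMorphism.Build tor_ring (inv_ring K n) tor_val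
    tor_val_monoid_morphism.
HB.instance Definition _ :=
  GRing.isScalable.Build K tor_ring (inv_ring K n) *:%R tor_val tor_val_scalable.

Definition toric_weight (f : inv_ring K n) (h : 'I_n.-1 -> nat) : Prop :=
  forall H : nilp K n, in_HU (val H) ->
    inv_fun f H = \prod_i subdiag (val H) i ^+ h i.

Definition toric_action
    (act : torus K n.-1 -> {lrmorphism tor_ring -> tor_ring}) : Prop :=
  [/\ forall f, act (torus1 K n.-1) f = f,
      forall c d f, act (torus_mul c d) f = act c (act d f) &
      forall c f h, toric_invariant (tor_val f) -> toric_weight (tor_val f) h ->
        act c f = (\prod_i tcoord c i ^+ h i) *: f].

Lemma root_char_subproof (t : torus K n) (i : 'I_n.-1) :
  tcoord t (sub_hi i) / tcoord t (sub_lo i) != 0.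
Proof. by rewrite mulf_neq0 ?invr_eq0 ?tcoord_neq0. Qed.

(* (t_1, .., t_n) |-> (t_2 / t_1, .., t_n / t_{n-1}) *)
Definition root_char (t : torus K n) : torus K n.-1 :=
  mktorus (root_char_subproof t).

End ToricInvariants.

(** * Affine varieties

  For a finitely generated algebra A over an algebraically closed field K, the
  closed points of Spec A are the K-algebra morphisms A -> K, and morphisms
  Spec A -> Spec B over K are the K-algebra morphisms B -> A. *)

Section Spec.
Variables (K : fieldType).
Implicit Types (A B : comAlgType K).

Definition kpoint A : Type := {lrmorphism A -> K | *%R}.

Definition zariski_closed A (Z : set (kpoint A)) : Prop :=
  exists S : set A, Z = [set x : kpoint A | forall f, S f -> x f = 0].

Definition zariski_dense A (Y : set (kpoint A)) : Prop :=
  forall Z, zariski_closed Z -> Y `<=` Z -> Z = setT.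

Definition spec_map A B (phi : {lrmorphism B -> A}) (y : kpoint A) : kpoint B :=
  y \o phi.

Definition dominant A B (phi : {lrmorphism B -> A}) : Prop :=
  zariski_dense (range (spec_map phi)).

(* An isomorphism of varieties psi : torus -> Y onto a subset Y of Spec A:
   a bijection that is a morphism (each f in A pulls back to a Laurent
   polynomial) and whose inverse is one (the coordinates of the inverse are
   quotients of regular functions with denominators vanishing nowhere on Y). *)
Definition torus_iso A m (psi : torus K m -> kpoint A) (Y : set (kpoint A)) : Prop :=
  [/\ injective psi, range psi = Y,
      forall f : A, exists (P : {mpoly K[m]}) (k : nat), forall c,
        psi c f = P.@[tcoord c] / (\prod_i tcoord c i) ^+ k &
      forall i, exists g h : A, forall c,
        psi c h != 0 /\ tcoord c i = psi c g / psi c h].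

Definition dense_orbit A m (act : torus K m -> {lrmorphism A -> A})
    (Y : set (kpoint A)) : Prop :=
  (exists x : kpoint A, Y = range (fun c => spec_map (act c) x)) /\
  zariski_dense Y.

End Spec.

(** * Scheme-theoretic fibres

  The fibre of Spec A -> Spec B over a K-point x of Spec B is the spectrum of
  A (x)_B K = A / (ker x) A. *)

Section Fibre.
Variables (K : fieldType) (A B : comAlgType K) (phi : {lrmorphism B -> A}).
Variable x : kpoint B.

Definition fibre_ideal : {pred A} :=
  fun f => `[< exists2 s : seq (A * B), (forall g, g \in s -> x g.2 = 0) &
                 f = \sum_(g <- s) g.1 * phi g.2 >].

Lemma fibre_idealMl (a f : A) : f \in fibre_ideal -> a * f \in fibre_ideal.
Proof.
move=> /asboolP[s hs ->]; apply/asboolP.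
exists [seq (a * g.1, g.2) | g <- s].
  by move=> _ /mapP[g gs ->] /=; apply: hs.
by rewrite big_map mulr_sumr; apply: eq_bigr => g _; rewrite mulrA.
Qed.

Lemma fibre_ideal_zmod : zmod_closed fibre_ideal.
Proof.
split; first by apply/asboolP; exists [::] => //; rewrite big_nil.
move=> f g hf /(@fibre_idealMl (-1)); rewrite mulN1r.
move: hf => /asboolP[s hs ->] /asboolP[r hr ->]; apply/asboolP.
exists (s ++ r); last by rewrite big_cat.
by move=> u; rewrite mem_cat => /orP[/hs|/hr].
Qed.
HB.instance Definition _ := GRing.isZmodClosed.Build A fibre_ideal
  fibre_ideal_zmod.

(* {ideal_quot _} would require the ideal to be proper, that is, the fibre to
   be nonempty. *)
Definition fibre_ring : Type := Quotient.quot fibre_ideal.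
HB.instance Definition _ := GRing.Zmodule.on fibre_ring.

Definition fibre_pi (f : A) : fibre_ring := (\pi_(Quotient.quot fibre_ideal) f)%qT.

Lemma fibre_piK (u : fibre_ring) : fibre_pi (repr u) = u.
Proof. exact: reprK. Qed.

Lemma fibre_piP (f g : A) : fibre_pi f = fibre_pi g <-> f - g \in fibre_ideal.
Proof. by rewrite (Quotient.idealrBE fibre_ideal); split=> [/eqP|/eqP]. Qed.

Lemma fibre_piD (f g : A) : fibre_pi (f + g) = fibre_pi f + fibre_pi g.
Proof. exact: (raddfD (\pi_(Quotient.quot fibre_ideal))%qT). Qed.

Definition fibre_one : fibre_ring := fibre_pi 1.
Definition fibre_mul (u v : fibre_ring) : fibre_ring :=
  fibre_pi (repr u * repr v).

Lemma fibre_piM (f g : A) : fibre_pi (f * g) = fibre_mul (fibre_pi f) (fibre_pi g).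
Proof.
have reprP h : repr (fibre_pi h) - h \in fibre_ideal.
  by apply/fibre_piP; rewrite fibre_piK.
set f' := repr (fibre_pi f); set g' := repr (fibre_pi g).
apply/esym/fibre_piP.
have -> : f' * g' - f * g = g' * (f' - f) + f * (g' - g).
  by rewrite !mulrBr [g' * f']mulrC [g' * f]mulrC addrA subrK.
by rewrite rpredD // fibre_idealMl // reprP.
Qed.

Lemma fibre_ind (P : fibre_ring -> Prop) :
  (forall f, P (fibre_pi f)) -> forall u, P u.
Proof. by move=> hP u; rewrite -[u]fibre_piK. Qed.

Lemma fibre_mulA : associative fibre_mul.
Proof.
by elim/fibre_ind=> f; elim/fibre_ind=> g; elim/fibre_ind=> h; rewrite -!fibre_piM mulrA.
Qed.

Lemma fibre_mulC : commutative fibre_mul.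
Proof.
by elim/fibre_ind=> f; elim/fibre_ind=> g; rewrite -!fibre_piM mulrC.
Qed.

Lemma fibre_mul1 : left_id fibre_one fibre_mul.
Proof. by elim/fibre_ind=> f; rewrite -fibre_piM mul1r. Qed.

Lemma fibre_mulDl : left_distributive fibre_mul +%R.
Proof.
elim/fibre_ind=> f; elim/fibre_ind=> g; elim/fibre_ind=> h.
by rewrite -fibre_piD -!fibre_piM mulrDl fibre_piD.
Qed.

HB.instance Definition _ := GRing.Zmodule_isComPzRing.Build fibre_ring
  fibre_mulA fibre_mulC fibre_mul1 fibre_mulDl.

(* Isomorphism of affine K-schemes: a K-algebra isomorphism, the structure map
   of the fibre being c |-> fibre_pi c%:A. *)
Definition fibre_iso_affine_space (D : nat) : Prop :=
  exists2 psi : {rmorphism fibre_ring -> {mpoly K[D]}},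
    bijective psi & forall c : K, psi (fibre_pi c%:A) = c%:MP.

End Fibre.

(** * The morphism p : N//U -> X *)

Section QuotientMorphism.
Variables (K : fieldType) (n : nat).

(* the comorphism of p *)
Definition tor_incl : {lrmorphism tor_ring K n -> inv_ring K n} := @tor_val K n.

Definition NmodU : Type := kpoint (inv_ring K n).
Definition toric_variety : Type := kpoint (tor_ring K n).
Definition tor_map : NmodU -> toric_variety := spec_map tor_incl.

End QuotientMorphism.

(* Main.v *)
From HB Require Import structures.
Require Import Defs.
From mathcomp Require Import all_boot all_order all_algebra.
From mathcomp Require Import boolp classical_sets reals complex mpoly.
From mathcomp Require Import spectral mxred ring zify.

Set Implicit Arguments.
Unset Strict Implicit.
Unset Printing Implicit Defensive.
Import GRing.Theory Num.Theory Defs.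
Local Open Scope ring_scope.
Local Open Scope classical_set_scope.

(** Write n = m + 1 and number rows and columns from 0. The proof rests on a
  slice for the action of U, given by explicit invariants.

  For a nilpotent matrix N let krylov N be the matrix whose rows are the last
  rows of N^m, ..., N, 1. Conjugating N by u in U multiplies krylov N on the
  right by the inverse of u, so every minor of krylov N on the first columns is
  an invariant. Let G_k be the leading minor of size k. Where no G_k vanishes,
  column operations from U make krylov N lower triangular, and then the
  relation between consecutive rows of krylov N forces the conjugated matrix to
  lie in H_U ([HU_reduction]). As the nilpotent cone is irreducible, for which
  it suffices that polynomial curves join every point to the shift matrix
  ([nilp_curve]), an invariant is determined by its restriction to H_U
  ([inv_eq_HU]).

  On H_U, krylov H is lower triangular with diagonal entries
  x_j x_(j+1) ... x_(m-1). Hence each G_k is a toric invariant, each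
  x_i = G_(i+1)^2 / (G_i G_(i+2)) is a quotient of toric ones, and solving the
  row relation for H shows that every entry of H, multiplied by a power of the
  product F of all G_k, extends to an invariant ([extends_entry]). Inverting F
  thus turns K[N]^U into the coordinate ring of H_U, the product of an
  m-dimensional torus and A^D.

  The function f^P of a datum is an eigenvector of T, whence a toric invariant
  restricts to a multiple of a monomial ([toric_monomial]). This gives the
  torus action on the toric ring as a restriction of the action of T, and its
  uniqueness ([toric_actionE]); evaluation along the orbit of the shift matrix
  identifies the dense orbit with the torus. At a point x of a dense orbit no
  G_k vanishes ([dense_orbit_lead_neq0]), so x is evaluation on the matrices of
  H_U with a prescribed subdiagonal c ([kpoint_tor], [kpoint_slice]). The ring
  of the fibre is then identified with the polynomials in the D entries below
  the subdiagonal: restriction to the slice with subdiagonal c has an inverse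
  modulo the ideal of the fibre, since there F may be replaced by the nonzero
  constant x(F) ([pi_lift_slice]). *)


(** * Polynomials vanishing on a torus *)

(** The positive integers already give more nonzero roots than the degree allows. *)
Lemma poly_eq0_neq0 (K : numFieldType) (p : {poly K}) :
  (forall s, s != 0 -> p.[s] = 0) -> p = 0.
Proof.
move=> hp; apply/eqP/negPn/negP => p0.
have := max_poly_roots (rs := [seq i.+1%:R | i <- iota 0 (size p)]) p0.
rewrite size_map size_iota ltnn map_inj_uniq ?iota_uniq; last first.
  by move=> i j /(mulrIn (oner_neq0 K)) [].
move=> H; suff: false by []; apply: H => //.
by apply/allP => _ /mapP[i _ ->]; rewrite rootE hp // pnatr_eq0.
Qed.

Section MuniEval.
Variables (K : fieldType) (k : nat).
Local Notation widen := (widen_ord (leqnSn k)).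

Lemma muni_horner (P : {mpoly K[k.+1]}) (v : 'I_k.+1 -> K) :
  (map_poly (meval (v \o widen)) (muni P)).[v ord_max] = P.@[v].
Proof.
rewrite muniE mevalE raddf_sum horner_sum; apply: eq_bigr => a _ /=.
rewrite map_polyZ map_polyXn hornerZ hornerXn /=.
rewrite [X in X * _](mevalZ _ _ _) mevalX big_ord_recr /= -mulrA.
by congr (_ * (_ * _)); apply: eq_bigr => i _; rewrite mnmE.
Qed.

(** Hence [muni] loses no coefficient, which is what makes induction on the
  number of variables possible. *)
Lemma muni_coef (P : {mpoly K[k.+1]}) (a : 'X_{1..k.+1}) :
  ((muni P)`_(a ord_max))@_[multinom (a (widen i)) | i < k] = P@_a.
Proof.
rewrite muniE coef_sum raddf_sum /= [in RHS](mpolyE P) [RHS]raddf_sum /=.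
apply: eq_bigr => b _; rewrite coefZ coefXn [RHS]mcoeffZ mcoeffX.
have [e|ne] := eqVneq (a ord_max) (b ord_max); last first.
  rewrite mulr0 mcoeff0; case: eqP => [e|]; last by rewrite mulr0.
  by rewrite e eqxx in ne.
rewrite mulr1 [LHS]mcoeffZ mcoeffX; congr (_ * (_ : bool)%:R).
apply/eqP/eqP => [/mnmP h|->] //; apply/mnmP => i.
case: (unliftP ord_max i) => [j|] -> //.
have := h j; rewrite !mnmE /=.
by congr (b _ = a _); apply/val_inj; rewrite /= /bump leqNgt ltn_ord.
Qed.

End MuniEval.

(** Equality of polynomials is tested on points throughout, and often only on
  the torus, where torus weights and subdiagonals of H_U live. One variable is
  split off at a time, so that [poly_eq0_neq0] applies. *)
Lemma mpoly_eq0_torus (K : numFieldType) (k : nat) (P : {mpoly K[k]}) :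
  (forall v : 'I_k -> K, (forall i, v i != 0) -> P.@[v] = 0) -> P = 0.
Proof.
elim: k P => [|k IH] P hP.
  apply/mpolyP => a; rewrite mcoeff0.
  have P0 : P.@[fun=> 0] = 0 by apply: hP => -[].
  move: P0.
  rewrite mevalE (eq_bigr (fun a => P@_a)); last first.
    by move=> b _; rewrite big_ord0 mulr1.
  have e0 b : b = a by apply/mnmP => -[].
  case: (boolP (a \in msupp P)) => [aP|/memN_msupp_eq0 //].
  rewrite (bigD1_seq a) //= ?msupp_uniq // big1 ?addr0 // => b.
  by rewrite (e0 b) eqxx.
apply/mpolyP => a; rewrite mcoeff0 -muni_coef.
suff -> : muni P = 0 by rewrite coef0 mcoeff0.
apply/polyP => j; rewrite coef0; apply: IH => v v0.
pose q := map_poly (meval v) (muni P).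
suff q0 : q = 0 by have := coef_map (meval v) (muni P) j; rewrite -/q q0 coef0.
apply: poly_eq0_neq0 => s s0.
pose w i := oapp v s (unlift ord_max i).
have wE : v = w \o widen_ord (leqnSn k).
  apply/funext => i /=; rewrite /w; case: unliftP => [i' e|e].
    by congr v; apply/val_inj; have /(congr1 val) := e; rewrite /= /bump leqNgt ltn_ord.
  by have /(congr1 val) /= h := e; have := ltn_ord i; rewrite h ltnn.
have := muni_horner P w; rewrite -wE {1}/w unlift_none /= -/q => ->.
by apply: hP => i; rewrite /w; case: unliftP => [i' _|_] //=.
Qed.

(** * Nilpotent matrices and irreducibility of the nilpotent cone *)

Section StrictlyLower.
Variables (K : comNzRingType) (m : nat).
Implicit Types H T : 'M[K]_m.+1.

(** H_U without the condition on the subdiagonal. *)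
Definition strictly_lower H : Prop := forall i j : 'I_m.+1, (i <= j)%N -> H i j = 0.

Lemma strictly_lower_exp_eq0 H k (i j : 'I_m.+1) :
  strictly_lower H -> (i < j + k)%N -> (H ^+ k) i j = 0.
Proof.
move=> hH; elim: k i j => [|k IH] i j lt.
  by rewrite expr0 mxE; case: eqP => // e; move: lt; rewrite e addn0 ltnn.
rewrite exprS mxE big1 // => l _.
case: (leqP i l) => il; first by rewrite hH ?mul0r.
by rewrite IH ?mulr0 //; lia.
Qed.

Lemma strictly_lower_expS H : strictly_lower H -> H ^+ m.+1 = 0.
Proof.
move=> hH; apply/matrixP => i j; rewrite strictly_lower_exp_eq0 ?mxE //.
by rewrite (leq_trans (ltn_ord i)) // leq_addl.
Qed.

(** The lowest nonzero diagonal of a power is computed from the subdiagonal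
  alone: this is the source of all monomials below. *)
Lemma strictly_lower_exp_diag H k (i j : 'I_m.+1) :
  strictly_lower H -> i = (j + k)%N :> nat ->
  (H ^+ k) i j = \prod_(j <= l < i) H (inord l.+1) (inord l).
Proof.
move=> hH; elim: k i j => [|k IH] i j ij.
  have -> : i = j by apply/val_inj; rewrite /= ij addn0.
  by rewrite expr0 mxE eqxx big_geq.
have jk : (j + k < m.+1)%N by have := ltn_ord i; rewrite ij; lia.
rewrite exprS mxE (bigD1 (Ordinal jk)) //= big1 ?addr0; last first.
  move=> l ne; case: (leqP i l) => il; first by rewrite hH ?mul0r.
  rewrite strictly_lower_exp_eq0 ?mulr0 //.
  have : (l != (j + k)%N :> nat) by []. lia.
rewrite (IH _ j) // ij addnS big_nat_recr /= ?leq_addr // mulrC.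
congr (_ * H _ _); apply/val_inj; rewrite /= inordK //.
by rewrite ij addnS. by have := ltn_ord i; lia.
Qed.

Lemma trig_exp_diag T k (i : 'I_m.+1) : is_trig_mx T -> (T ^+ k) i i = T i i ^+ k.
Proof.
move=> /is_trig_mxP hT.
suff: forall a, (T ^+ k) a a = T a a ^+ k /\
   forall b : 'I_m.+1, (a < b)%N -> (T ^+ k) a b = 0 by move=> /(_ i)[].
elim: k => [|k IH] a.
  split=> [|b ab]; rewrite !expr0 mxE ?eqxx //.
  by case: eqP => // e; rewrite e ltnn in ab.
split=> [|b ab]; rewrite !exprS mxE.
  rewrite (bigD1 a) //= (IH a).1 big1 ?addr0 // => l la.
  case: (ltngtP a l) => al; first by rewrite hT ?mul0r.
    by rewrite (IH l).2 ?mulr0.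
  by move: la; rewrite (val_inj al) eqxx.
rewrite big1 // => l _; case: (ltnP a l) => al; first by rewrite hT ?mul0r.
by rewrite (IH l).2 ?mulr0 // (leq_ltn_trans al).
Qed.

(** Conjugation with the adjugate in place of the inverse preserves nilpotency
  even for a singular matrix and is polynomial in its entries, which is what
  [nilp_curve] needs. *)
Lemma adj_conjX (g L : 'M[K]_m.+1) k :
  (g *m L *m \adj g) ^+ k.+1 = (\det g) ^+ k *: (g *m L ^+ k.+1 *m \adj g).
Proof.
elim: k => [|k IH]; first by rewrite !expr1 expr0 scale1r.
rewrite exprS IH -mulmxE -scalemxAr !mulmxA -(mulmxA _ (\adj g) g) mul_adj_mx.
rewrite mul_mx_scalar -!scalemxAl scalerA -exprSr.
by rewrite -(mulmxA g L) mulmxE -exprS.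
Qed.

Definition shift_mx : 'M[K]_m.+1 := \matrix_(i, j) (i == j.+1 :> nat)%:R.

Lemma shift_mx_lower : strictly_lower shift_mx.
Proof. by move=> i j ij; rewrite mxE; case: eqP => // e; move: ij; rewrite e ltnn. Qed.

End StrictlyLower.
Arguments shift_mx : clear implicits.

Lemma strictly_lower_nilp (K : fieldType) m (H : 'M[K]_m.+1) :
  strictly_lower H -> is_nilp H.
Proof. by move=> hH; apply/asboolP; exists m.+1; exact: strictly_lower_expS. Qed.

Section Curve.
Variables (K : numClosedFieldType) (m : nat).

(** A nilpotent matrix in Schur form has zero diagonal. *)
Lemma nilp_trig (M : 'M[K]_m.+1) : is_nilp M ->
  exists g L, [/\ g \in unitmx, strictly_lower L & M = g *m L *m invmx g].
Proof.
move=> /asboolP[k Mk].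
have [P Pu tP] := Schur M (ltn0Sn m).
have PU := unitarymx_unit Pu.
move: tP; rewrite /similar_to conjumx // => tP.
exists (invmx P), (P *m M *m invmx P); split.
- by rewrite unitmx_inv.
- move=> i j; rewrite leq_eqVlt => /orP[/eqP/val_inj <-|ij]; last first.
    by move/is_trig_mxP: tP; apply.
  have := trig_exp_diag k i tP; rewrite conjX // Mk mulmx0 mul0mx mxE => /esym/eqP.
  by rewrite expf_eq0 => /andP[_ /eqP].
- by rewrite invmxK !mulmxA mulVmx // mul1mx mulmxKV.
Qed.

Lemma nilp_expS (M : 'M[K]_m.+1) : is_nilp M -> M ^+ m.+1 = 0.
Proof.
move=> /nilp_trig[g [L [gU hL ->]]].
by rewrite conjX // strictly_lower_expS // mulmx0 mul0mx.
Qed.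

Definition jordan_nilp : nilp K m.+1 :=
  Sub (shift_mx K m) (strictly_lower_nilp (@shift_mx_lower K m)).

(** Write N = g L g^-1 with L strictly lower triangular, move g to 1 and
  L / det g to the shift matrix along segments, and conjugate with the
  adjugate. The curve never leaves the nilpotent cone, even at the parameters
  where g degenerates. *)
Lemma nilp_curve (N : nilp K m.+1) :
  exists C : 'M[{poly K}]_m.+1,
    [/\ forall s, is_nilp (map_mx (horner_eval s) C),
        map_mx (horner_eval 0) C = val N &
        map_mx (horner_eval 1) C = shift_mx K m].
Proof.
have [g [L [gU hL NE]]] := nilp_trig (valP N).
pose J := shift_mx K m.
pose G : 'M[{poly K}]_m.+1 := (1 - 'X) *: map_mx polyC g + 'X%:M.
(* dividing by det g makes the curve pass through N itself at parameter 0 *)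
pose L' : 'M[{poly K}]_m.+1 :=
  (1 - 'X) *: map_mx polyC ((\det g)^-1 *: L) + 'X *: map_mx polyC J.
have GE s : map_mx (horner_eval s) G = (1 - s) *: g + s%:M.
  apply/matrixP => i j; rewrite !mxE /horner_eval !hornerE.
  by case: eqP => _; rewrite ?mulr1n ?mulr0n hornerE.
have LE s : map_mx (horner_eval s) L' = (1 - s) *: ((\det g)^-1 *: L) + s *: J.
  by apply/matrixP => i j; rewrite !mxE /horner_eval !hornerE.
pose C := G *m L' *m \adj G.
have CE s : map_mx (horner_eval s) C =
    map_mx (horner_eval s) G *m map_mx (horner_eval s) L' *m
    \adj (map_mx (horner_eval s) G).
  by rewrite !map_mxM map_mx_adj.
exists C; split=> [s||].
- apply/asboolP; exists m.+1; rewrite CE adj_conjX strictly_lower_expS.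
    by rewrite mulmx0 mul0mx scaler0.
  move=> i j ij; rewrite LE mxE !mxE hL // !mulr0 add0r.
  by case: eqP => [e|]; rewrite ?mulr0 //; move: ij; rewrite e ltnn.
- rewrite CE GE LE subr0 !scale1r scale0r addr0 raddf0 addr0.
  by rewrite NE /invmx gU -!scalemxAr -scalemxAl.
- by rewrite CE GE LE subrr !scale0r scale1r !add0r adj1 !(mul1mx, mulmx1).
Qed.

Lemma mpoly_curve k (P : {mpoly K[k]}) (v : 'I_k -> {poly K}) :
  exists q : {poly K}, forall s, q.[s] = P.@[fun i => (v i).[s]].
Proof.
exists (mmap polyC v P) => s; rewrite mevalE /mmap horner_sum.
apply: eq_bigr => a _; rewrite hornerM hornerC /mmap1 horner_prod.
by congr (_ * _); apply: eq_bigr => i _; rewrite horner_exp.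
Qed.

(** Irreducibility of the nilpotent cone, in the form used here: along a curve
  through N and the shift matrix the two functions are polynomials in one
  variable, and the second is not the zero polynomial. *)
Lemma nilp_regular_mul_eq0 (f g : nfun K m.+1) :
  regular f -> regular g -> (forall N, f N * g N = 0) -> g jordan_nilp != 0 ->
  forall N, f N = 0.
Proof.
move=> [P fP] [Q gQ] fg gJ N.
have [C [Cn C0 C1]] := nilp_curve N.
pose v k := mxvec C 0 k.
have vE s k : (v k).[s] = mxvec (map_mx (horner_eval s) C) 0 k.
  by rewrite -map_mxvec mxE.
have [p pE] := mpoly_curve P v; have [q qE] := mpoly_curve Q v.
have pC s : p.[s] = f (Sub _ (Cn s)).
  by rewrite pE fP; apply: meval_eq => k; rewrite vE.
have qC s : q.[s] = g (Sub _ (Cn s)).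
  by rewrite qE gQ; apply: meval_eq => k; rewrite vE.
have : p * q = 0.
  by apply: poly_eq0_neq0 => s _; rewrite hornerM pC qC fg.
move/eqP; rewrite mulf_eq0 => /orP[]/eqP e.
  have <- : Sub _ (Cn 0) = N by apply: val_inj; rewrite /= C0.
  by rewrite -pC e horner0.
case/eqP: gJ; have <- : Sub _ (Cn 1) = jordan_nilp by apply: val_inj; rewrite /= C1.
by rewrite -qC e horner0.
Qed.
End Curve.

(** * Minors on the first columns *)

Section Minors.
Variables (R : comNzRingType) (m : nat).
Implicit Types A : 'M[R]_m.+1.

(** Only the first k columns occur because a unitriangular matrix acting on the
  right adds to each column multiples of earlier ones. *)
Definition left_minor A k (rho : 'I_k -> 'I_m.+1) : R :=
  \det (\matrix_(a < k, b < k) A (rho a) (inord b)).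

Definition lead_minor A k : R := left_minor A (fun a : 'I_k => inord a).

Definition bordered_minor A (i j : 'I_m.+1) : R :=
  left_minor A (fun a : 'I_j.+1 => if (a < j)%N then inord a else i).

(** Beyond the size of the matrix [inord] is 0, so that column 0 occurs twice. *)
Lemma left_minor_big A k (rho : 'I_k -> 'I_m.+1) :
  (m.+1 < k)%N -> left_minor A rho = 0.
Proof.
move=> mk; rewrite /left_minor -det_tr.
apply: (@determinant_alternate _ _ _ (Ordinal (ltn_trans (ltn0Sn m) mk)) (Ordinal mk)) => // a.
rewrite !mxE; congr (A _ _); apply/val_inj => /=.
by rewrite inordK // /inord /insubd insubN //= ltnn.
Qed.

Lemma left_minor_unitriangular A (u : 'M[R]_m.+1) k (rho : 'I_k -> 'I_m.+1) :
  (forall i j : 'I_m.+1, (j < i)%N -> u i j = 0) -> (forall i, u i i = 1) ->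
  left_minor (A *m u) rho = left_minor A rho.
Proof.
move=> u0 u1; case: (leqP k m.+1) => km; last by rewrite !left_minor_big.
pose v : 'M[R]_k := \matrix_(a, b) u (inord a) (inord b).
have ik (a : 'I_k) : (inord a : 'I_m.+1) = a :> nat.
  by rewrite inordK // (leq_trans (ltn_ord a)).
have -> : left_minor A rho = left_minor A rho * \det v.
  rewrite -[v]trmxK det_tr det_trig; last first.
    by apply/is_trig_mxP => a b ab; rewrite !mxE u0 // !ik.
  by rewrite big1 ?mulr1 // => a _; rewrite !mxE u1.
rewrite -det_mulmx; congr (\det _); apply/matrixP => a b; rewrite !mxE.
rewrite (bigID (fun l : 'I_m.+1 => (l < k)%N)) /= [X in _ + X]big1 ?addr0.
  rewrite (big_ord_narrow km); apply: eq_bigr => l _; rewrite !mxE.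
  by congr (A _ _ * u _ _); apply/val_inj; rewrite /= ik.
by move=> l; rewrite -leqNgt => kl; rewrite u0 ?mulr0 // ik (leq_trans (ltn_ord b)).
Qed.

Section Lower.
Variable A : 'M[R]_m.+1.
Hypothesis lowA : forall i j : 'I_m.+1, (i < j)%N -> A i j = 0.

Lemma lead_minor_lower k : (k <= m.+1)%N ->
  lead_minor A k = \prod_(a < k) A (inord a) (inord a).
Proof.
move=> km; rewrite /lead_minor /left_minor det_trig.
  by apply: eq_bigr => a _; rewrite mxE.
apply/is_trig_mxP => a b ab; rewrite mxE lowA // !inordK //;
  by [rewrite (leq_trans (ltn_ord a))|rewrite (leq_trans (ltn_ord b))].
Qed.

(** These minors recover the entries of a lower triangular matrix up to leading
  minors. *)
Lemma bordered_minor_lower i j : bordered_minor A i j = lead_minor A j * A i j.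
Proof.
have jm := ltnW (ltn_ord j).
rewrite lead_minor_lower // /bordered_minor /left_minor det_trig.
  rewrite big_ord_recr /= !mxE ltnn; congr (_ * A _ _).
    by apply: eq_bigr => a _; rewrite mxE /= ltn_ord.
  by apply/val_inj; rewrite /= inordK.
apply/is_trig_mxP => a b ab; rewrite mxE.
have bj := ltn_ord b; have jm' := ltn_ord j.
have -> : (a < j)%N by lia.
by rewrite lowA // !inordK; lia.
Qed.

End Lower.
End Minors.

(** If L is lower triangular with invertible diagonal and right multiplication
  by N shifts the rows of L down, then N can be solved for row by row, and it
  comes out strictly lower triangular with invertible subdiagonal. *)
Lemma lower_shift (K : fieldType) m (L N : 'M[K]_m.+1) :
  (forall i j : 'I_m.+1, (i < j)%N -> L i j = 0) -> (forall i, L i i != 0) ->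
  (forall i l, (L *m N) i l = if i == ord0 then 0 else L (inord i.-1) l) ->
  strictly_lower N /\
  forall i : 'I_m.+1, (0 < i)%N -> L i i * N i (inord i.-1) = L (inord i.-1) (inord i.-1).
Proof.
move=> lowL L0 LN.
have NE (i l : 'I_m.+1) : (forall k : 'I_m.+1, (k < i)%N -> N k l = 0) ->
    L i i * N i l = if i == ord0 then 0 else L (inord i.-1) l.
  move=> h; rewrite -LN mxE (bigD1 i) //= big1 ?addr0 // => k ki.
  case: (ltngtP k i) => ik; first by rewrite h ?mulr0.
    by rewrite lowL ?mul0r.
  by rewrite (val_inj ik) eqxx in ki.
have sN : strictly_lower N.
  move=> i; have [k] := ubnP (nat_of_ord i); elim: k i => // k IH i ik j ij.
  apply/eqP; rewrite -(inj_eq (mulfI (L0 i))) mulr0; apply/eqP.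
  rewrite NE => [|l li]; last first.
    by apply: IH; lia.
  case: eqP => // i0; rewrite lowL // inordK; last by have := ltn_ord i; lia.
  have : nat_of_ord i <> 0%N by move=> e; apply: i0; apply/val_inj.
  lia.
split=> // i i0; rewrite NE; first by case: eqP => // e; rewrite e in i0.
by move=> k ki; rewrite sN // inordK; have := ltn_ord i; lia.
Qed.

(** * Krylov matrices and the slice H_U *)

Section Krylov.
Variables (R : comNzRingType) (m : nat).
Implicit Types N : 'M[R]_m.+1.

(** The last coordinate row vector is fixed by U, so its translates by powers of
  N form a matrix on which U acts by right multiplication. *)
Definition krylov N : 'M[R]_m.+1 := \matrix_(j, l) (N ^+ (m - j)) ord_max l.

Lemma krylov_shift N i l : N ^+ m.+1 = 0 ->
  (krylov N *m N) i l = if i == ord0 then 0 else krylov N (inord i.-1) l.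
Proof.
move=> Nm; have -> : (krylov N *m N) i l = (N ^+ (m - i).+1) ord_max l.
  by rewrite exprSr !mxE; apply: eq_bigr => k _; rewrite mxE.
have im := ltn_ord i.
case: eqP => [->|i0]; first by rewrite subn0 Nm mxE.
have i0' : nat_of_ord i <> 0%N by move=> e; apply: i0; apply/val_inj.
rewrite mxE inordK; last by lia.
by have -> : (m - i.-1 = (m - i).+1)%N by lia.
Qed.

Lemma krylov_lower N (i j : 'I_m.+1) : strictly_lower N -> (i < j)%N -> krylov N i j = 0.
Proof.
move=> hN ij; rewrite mxE strictly_lower_exp_eq0 //=.
by have := ltn_ord j; lia.
Qed.

Lemma krylov_diag N (j : 'I_m.+1) : strictly_lower N ->
  krylov N j j = \prod_(j <= l < m) N (inord l.+1) (inord l).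
Proof.
move=> hN; rewrite mxE (strictly_lower_exp_diag hN) //=.
by have := ltn_ord j; lia.
Qed.

End Krylov.

Lemma map_krylov (R S : comNzRingType) (f : {rmorphism R -> S}) m (N : 'M[R]_m.+1) :
  map_mx f (krylov N) = krylov (map_mx f N).
Proof. by apply/matrixP => i j; rewrite !mxE -rmorphXn mxE. Qed.

Lemma map_left_minor (R S : comNzRingType) (f : {rmorphism R -> S}) m k
    (A : 'M[R]_m.+1) (rho : 'I_k -> 'I_m.+1) :
  f (left_minor A rho) = left_minor (map_mx f A) rho.
Proof.
by rewrite -det_map_mx; congr (\det _); apply/matrixP => i j; rewrite !mxE.
Qed.

Section KrylovField.
Variables (K : numClosedFieldType) (m : nat).
Implicit Types N : 'M[K]_m.+1.

(** The last row of a unitriangular u is that of the identity. *)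
Lemma krylov_conj N (u : 'M[K]_m.+1) : u \in unitmx -> unitriangular u ->
  krylov (u *m N *m invmx u) *m u = krylov N.
Proof.
move=> uU [u0 u1]; apply/matrixP => i j.
transitivity (((u *m N *m invmx u) ^+ (m - i) *m u) ord_max j).
  by rewrite !mxE; apply: eq_bigr => k _; rewrite mxE.
rewrite conjX // mulmxKV // mxE (bigD1 ord_max) //= u1 mul1r big1 ?addr0 ?mxE //.
move=> k kmax; rewrite u0 ?mul0r //=.
have : nat_of_ord k <> m by move=> e; case/eqP: kmax; apply/val_inj.
by have := ltn_ord k; lia.
Qed.

Definition krylov_minor k (rho : 'I_k -> 'I_m.+1) : nfun K m.+1 :=
  fun N : nilp K m.+1 => left_minor (krylov (val N)) rho.

(** Regularity is read off from the same minor of the generic matrix. *)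
Lemma krylov_minor_subproof k (rho : 'I_k -> 'I_m.+1) :
  krylov_minor rho \in @inv_pred K m.+1.
Proof.
apply/inv_predP; split; last first.
  move=> u uU uT N; have [u0 u1] := uT; rewrite /krylov_minor /=.
  by rewrite -(krylov_conj (val N) uU uT) left_minor_unitriangular.
pose X : 'M[{mpoly K[m.+1 * m.+1]}]_m.+1 := \matrix_(i, j) 'X_(mxvec_index i j).
exists (left_minor (krylov X) rho) => N.
set v := (fun k => _).
rewrite -[RHS]/((meval v : {rmorphism _ -> _}) _) map_left_minor map_krylov.
rewrite /krylov_minor; suff -> : val N = map_mx (meval v) X by [].
by apply/matrixP => i j; rewrite !mxE mevalXU /v mxvecE.
Qed.

Definition minor_inv k (rho : 'I_k -> 'I_m.+1) : inv_ring K m.+1 :=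
  InvRing (krylov_minor_subproof rho).

Definition lead_inv k : inv_ring K m.+1 := minor_inv (fun a : 'I_k => inord a).

Definition bordered_inv (i j : 'I_m.+1) : inv_ring K m.+1 :=
  minor_inv (fun a : 'I_j.+1 => if (a < j)%N then inord a else i).

End KrylovField.

Section GenericSlice.
Variables (K : numClosedFieldType) (m : nat).

(** The part of LU decomposition that is needed: column j of u above the
  diagonal solves the linear system with the leading block of size j. *)
Lemma lower_reduction (A : 'M[K]_m.+1) :
  (forall k, (k <= m.+1)%N -> lead_minor A k != 0) ->
  exists2 u : 'M[K]_m.+1, unitriangular u &
    forall i j : 'I_m.+1, (i < j)%N -> (A *m u) i j = 0.
Proof.
move=> hA.
pose B (j : 'I_m.+1) : 'M[K]_j := \matrix_(a, b) A (inord a) (inord b).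
pose c (j : 'I_m.+1) : 'cV[K]_j := \col_a A (inord a) j.
(* solution of B j w = - c j; the block has the leading minor as determinant *)
pose w (j : 'I_m.+1) : 'cV[K]_j := - (invmx (B j) *m c j).
have BU j : B j \in unitmx by rewrite unitmxE unitfE hA // ltnW.
pose u : 'M[K]_m.+1 := \matrix_(k, j) oapp (fun a : 'I_j => w j a 0) (k == j)%:R (insub (val k)).
have ugt (k j : 'I_m.+1) : (j <= k)%N -> u k j = (k == j)%:R.
  by move=> jk; rewrite mxE insubN //= -leqNgt.
exists u; first split.
- by move=> k j jk; rewrite ugt ?(ltnW jk) //; case: eqP => // e; rewrite e ltnn in jk.
- by move=> k; rewrite ugt // eqxx.
move=> i j ij; have jm := ltnW (ltn_ord j).
rewrite mxE (bigID (fun l : 'I_m.+1 => (l < j)%N)) /= (big_ord_narrow jm).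
rewrite [X in _ + X](bigD1 j) ?ltnn //= ugt // eqxx mulr1 [X in _ + (_ + X)]big1; last first.
  move=> l /andP[]; rewrite -leqNgt => jl lj; rewrite ugt // (negbTE lj) mulr0 //.
have := mulKVmx (BU j) (c j) => /(congr1 (fun M : 'cV_j => M (Ordinal ij) 0)).
rewrite mxE [RHS]mxE => e.
have -> : \sum_(l < j) A i (widen_ord jm l) * u (widen_ord jm l) j = - A i j.
  have -> : A i j = A (inord (Ordinal ij)) j by congr (A _ _); apply/val_inj; rewrite /= inordK.
  rewrite -e -sumrN; apply: eq_bigr => l _; rewrite !mxE.
  have li : (val (widen_ord jm l) < j)%N by rewrite /= ltn_ord.
  rewrite (insubT (fun x => (x < j)%N) li) /= !mxE mulrN; congr (- (A _ _ * _)).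
  - by apply/val_inj; rewrite /= inordK.
  - by apply/val_inj; rewrite /= inordK // (leq_trans (ltn_ord l)).
  - by apply: eq_bigr => a _; congr (invmx _ _ _ * _); apply/val_inj.
by rewrite addr0 addNr.
Qed.

Lemma lead_inv_HU_neq0 (H : nilp K m.+1) k :
  in_HU (val H) -> (k <= m.+1)%N -> inv_fun (lead_inv K m k) H != 0.
Proof.
move=> [hH H0] km; rewrite [inv_fun _ _]lead_minor_lower // => [|i j]; last exact: krylov_lower.
apply/prodf_neq0 => a _; rewrite krylov_diag // big_seq; elim/big_ind: _ => [|x y x0 y0|l].
- exact: oner_neq0.
- by rewrite mulf_neq0.
rewrite mem_index_iota => /andP[_ lm].
have := H0 (Ordinal (lm : (l < m.+1.-1)%N)); rewrite /subdiag.
by congr (val H _ _ != 0); apply/val_inj; rewrite /= inordK // ltnW.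
Qed.

(** After [lower_reduction] the Krylov matrix of the conjugate is lower
  triangular, and [krylov_shift] makes [lower_shift] applicable. *)
Lemma HU_reduction (N : nilp K m.+1) :
  (forall k, (k <= m.+1)%N -> inv_fun (lead_inv K m k) N != 0) ->
  exists u (uU : u \in unitmx) (H : nilp K m.+1),
    [/\ unitriangular u, in_HU (val H) & N = nilp_conj uU H].
Proof.
move=> hN; have [u uT lowu] := lower_reduction hN.
have uU : u \in unitmx.
  have [u0 u1] := uT; rewrite -unitmx_tr unitmxE det_trig.
    by rewrite big1 ?unitr1 // => i _; rewrite mxE u1.
  by apply/is_trig_mxP => i j ij; rewrite mxE u0.
have vU : invmx u \in unitmx by rewrite unitmx_inv.
pose H := nilp_conj vU N.
have NE : N = nilp_conj uU H.
  by apply: val_inj; rewrite /= invmxK !mulmxA mulmxV // mul1mx mulmxK.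
have kE : krylov (val H) = krylov (val N) *m u.
  have := krylov_conj (val H) uU uT.
  rewrite -[u *m _ *m _]/(val (nilp_conj uU H)) -NE => ->.
  by [].
have low (i j : 'I_m.+1) : (i < j)%N -> krylov (val H) i j = 0 by rewrite kE; exact: lowu.
have lead_neq0 k : (k <= m.+1)%N -> lead_minor (krylov (val H)) k != 0.
  move=> km; rewrite kE /lead_minor left_minor_unitriangular; first exact: hN.
    by case: uT.
  by case: uT.
have diag_neq0 i : krylov (val H) i i != 0.
  have := lead_neq0 i.+1 (ltn_ord i); rewrite lead_minor_lower // => /prodf_neq0.
  by move=> /(_ ord_max isT); rewrite /= inord_val.
have [sH HE] := lower_shift low diag_neq0 (fun i l => krylov_shift i l (nilp_expS (valP H))).
exists u, uU, H; split=> //; split=> // i.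
apply/eqP => e; have := HE (sub_hi i) isT.
have -> : inord (sub_hi i).-1 = sub_lo i.
  by apply/val_inj; rewrite /= inordK //; have := ltn_ord i => /=; lia.
by move: e; rewrite /subdiag => ->; rewrite mulr0 => /esym/eqP; apply/negP.
Qed.

Definition lead_prod : inv_ring K m.+1 := \prod_(k < m.+2) lead_inv K m k.

Lemma inv_fun_prod I (r : seq I) (P : pred I) (f : I -> inv_ring K m.+1) N :
  inv_fun (\prod_(i <- r | P i) f i) N = \prod_(i <- r | P i) inv_fun (f i) N.
Proof. by elim/big_rec2: _ => // i x y _ <-. Qed.

Lemma inv_fun_regular (f : inv_ring K m.+1) : regular (inv_fun f).
Proof. by case: f => f /= /inv_predP[]. Qed.

Lemma jordan_in_HU : in_HU (val (jordan_nilp K m)).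
Proof.
split=> [|i]; first exact: shift_mx_lower.
by rewrite /subdiag mxE /= eqxx oner_neq0.
Qed.

(** The difference vanishes wherever no leading minor does, so its product with
  [lead_prod] vanishes identically. *)
Lemma inv_eq_HU (f g : inv_ring K m.+1) :
  (forall H, in_HU (val H) -> inv_fun f H = inv_fun g H) -> f = g.
Proof.
move=> fg; apply/eqP; rewrite -subr_eq0; apply/eqP; apply: val_inj; apply/funext => N /=.
apply: (nilp_regular_mul_eq0 (inv_fun_regular (f - g)) (inv_fun_regular lead_prod)).
  move=> {}N; have [hN|/existsNP[k /not_implyP[km]]] :=
    pselect (forall k, (k <= m.+1)%N -> inv_fun (lead_inv K m k) N != 0).
    have [u [uU [H [uT HH ->]]]] := HU_reduction hN.
    have /inv_predP[_ -> //] := valP (f - g).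
    by rewrite [X in X * _](_ : _ = inv_fun f H - inv_fun g H) // fg // subrr mul0r.
  move=> /negP/negPn/eqP h; apply/eqP; rewrite inv_fun_prod mulf_eq0; apply/orP; right.
  by apply/prodf_eq0; exists (Ordinal (km : (k < m.+2)%N)) => //; apply/eqP; exact: h.
rewrite inv_fun_prod; apply/prodf_neq0 => k _.
by apply: lead_inv_HU_neq0; [exact: jordan_in_HU|rewrite -ltnS].
Qed.

End GenericSlice.

(** * Data, torus weights and toric invariants *)

Arguments da {K n} _ _.
Arguments da' {K n} _ _.
Arguments da_le {K n} _ _.
Arguments da'_le {K n} _ _.
Arguments dP {K n} _ _ _.

Section DatumEntries.
Variables (K : fieldType) (n : nat).
Implicit Types (P : datum K n) (M : 'M[K]_n).

Definition datum_row P (k : 'I_(\sum_i da P i)) : 'I_n :=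
  rev_ord (widen_ord (da_le P (tagnat.sig1 k)) (rev_ord (tagnat.sig2 k))).

Definition datum_col P (l : 'I_(\sum_j da' P j)) : 'I_n :=
  widen_ord (da'_le P (tagnat.sig1 l)) (tagnat.sig2 l).

(** This form hides the block structure: each entry is an entry of a polynomial
  in M, in a row and a column that depend on the datum only. *)
Lemma datum_funE P M :
  datum_fun P M = \det (\matrix_(k, l)
    polymx (dP P (tagnat.sig1 k) (tagnat.sig1 (cast_ord (da_sum P) l))) M
      (datum_row k) (datum_col (cast_ord (da_sum P) l))).
Proof.
congr (\det _); apply/matrixP => k l; rewrite castmxE !mxE cast_ord_id.
by rewrite esymK.
Qed.

Lemma polymx_conj (Q : {poly K}) M (g : 'M[K]_n) : g \in unitmx ->
  polymx Q (g *m M *m invmx g) = g *m polymx Q M *m invmx g.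
Proof.
move=> gU; rewrite /polymx mulmx_sumr mulmx_suml; apply: eq_bigr => i _.
by rewrite conjX // -scalemxAr -scalemxAl.
Qed.

Lemma det_scale_rows_cols r (A : 'M[K]_r) (a b : 'I_r -> K) :
  \det (\matrix_(k, l) (a k * A k l * b l)) = (\prod_k a k) * (\prod_l b l) * \det A.
Proof.
have -> : \matrix_(k, l) (a k * A k l * b l) =
    diag_mx (\row_k a k) *m A *m diag_mx (\row_k b k).
  by rewrite mul_mx_diag mul_diag_mx; apply/matrixP => k l; rewrite !mxE.
rewrite !det_mulmx !det_diag mulrAC.
by congr (_ * _ * _); apply: eq_bigr => i _; rewrite mxE.
Qed.

(** Conjugation by t rescales the rows and columns of the block matrix. *)
Lemma datum_fun_conj P (t : torus K n) :
  exists c, forall M, datum_fun P (tdiag t *m M *m invmx (tdiag t)) = c * datum_fun P M.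
Proof.
exists ((\prod_(k < \sum_i da P i) tcoord t (datum_row k)) *
  \prod_(l < \sum_i da P i) (tcoord t (datum_col (cast_ord (da_sum P) l)))^-1) => M.
rewrite !datum_funE -det_scale_rows_cols.
congr (\det _); apply/matrixP => k l; rewrite !mxE polymx_conj ?tdiag_unit //.
by rewrite tdiag_conjE.
Qed.

Lemma polymxXn d M : polymx 'X^d M = M ^+ d.
Proof.
rewrite /polymx size_polyXn big_ord_recr /= coefXn eqxx scale1r big1 ?add0r //.
by move=> i _; rewrite coefXn ltn_eqF // scale0r.
Qed.

Lemma polymxZ (c : K) (Q : {poly K}) M : polymx (c *: Q) M = c *: polymx Q M.
Proof.
have [->|c0] := eqVneq c 0.
  by rewrite !scale0r /polymx size_poly0 big_ord0.
rewrite /polymx size_scale // scaler_sumr; apply: eq_bigr => i _.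
by rewrite coefZ scalerA.
Qed.

(** Scaling all polynomials by c scales the determinant by a power of c; over an
  algebraically closed field every scalar is reached, see [toric_scale]. *)
Definition datum_scale (c : K) P : datum K n :=
  Datum (ds_gt0 P) (dt_gt0 P) (@da_gt0 _ _ P) (@da_le _ _ P) (@da'_gt0 _ _ P)
    (@da'_le _ _ P) (da_sum P) (fun i j => c *: dP P i j).

Lemma datum_fun_scale c P M :
  datum_fun (datum_scale c P) M = c ^+ (\sum_i da P i) * datum_fun P M.
Proof.
rewrite !datum_funE -detZ; congr (\det _); apply/matrixP => k l.
by rewrite !mxE /= polymxZ mxE.
Qed.

Lemma datum_size_gt0 P : (0 < \sum_i da P i)%N.
Proof.
by rewrite (bigD1 (Ordinal (ds_gt0 P))) //= ltn_addr // da_gt0.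
Qed.

End DatumEntries.

Section LeadDatum.
Variables (K : fieldType) (m k : nat).
Hypotheses (k_gt0 : (0 < k)%N) (k_le : (k <= m.+1)%N).

Lemma lead_datum_sum : (\sum_(i < k) 1 = \sum_(j < 1) k)%N.
Proof. by rewrite sum1_card card_ord big_ord1. Qed.

(** Blocks of one row each and a single block column present the leading minor of
  the Krylov matrix as the function of a datum. *)
Definition lead_datum : datum K m.+1 :=
  @Datum K m.+1 k 1 k_gt0 isT (fun=> 1%N) (fun=> k) (fun=> isT) (fun=> isT)
    (fun=> k_gt0) (fun=> k_le) lead_datum_sum (fun i _ => 'X^(m - i)).

Lemma det_cast r s (e : r = s) (A : 'M[K]_r) (B : 'M[K]_s) :
  (forall i j, A i j = B (cast_ord e i) (cast_ord e j)) -> \det A = \det B.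
Proof.
by subst s => h; congr (\det _); apply/matrixP => i j; rewrite h !cast_ord_id.
Qed.

Lemma lead_datumE M : datum_fun lead_datum M = lead_minor (krylov M) k.
Proof.
have e : (\sum_(i < k) 1 = k)%N by rewrite sum1_card card_ord.
rewrite datum_funE; apply: (det_cast (e := e)) => a b; rewrite !mxE /= polymxXn.
(* all row blocks have height 1, so the block index is the row index *)
have sa : nat_of_ord (tagnat.sig1 a) = a.
  rewrite [RHS]tagnat.rect [X in (_ + X)%N](_ : _ = 0%N) ?addn0; last first.
    by case: (tagnat.sig2 a) => -[].
  rewrite sum1_card (eq_card (B := [pred i : 'I_k | (i < tagnat.sig1 a)%N])) //.
  by rewrite -sum1_card (big_ord_narrow (ltnW (ltn_ord _))) sum1_card card_ord.
have lek (x : 'I_(\sum_(i < k) 1)) : (x < m.+1)%N.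
  by rewrite (leq_trans _ k_le) // -[X in (_ < X)%N]e ltn_ord.
have ra : @datum_row _ _ lead_datum a = ord_max.
  by apply/val_inj => /=; move: (tagnat.sig2 a) => /= -[[|x] //= _]; lia.
have cb : @datum_col _ _ lead_datum (cast_ord lead_datum_sum b) = inord b.
  apply/val_inj; rewrite /= inordK //; symmetry.
  have /= := tagnat.rect (cast_ord lead_datum_sum b).
  by rewrite [X in _ = (X + _)%N -> _]big1 // => i; case: (tagnat.sig1 _) => -[].
by rewrite sa ra cb inordK.
Qed.

End LeadDatum.

Section ToricInvariants.
Variables (K : numClosedFieldType) (m : nat).
Local Notation J := (jordan_nilp K m).

Lemma toric_part_lower (H : 'M[K]_m.+1) : strictly_lower (toric_part H).
Proof. by move=> i j ij; rewrite mxE; case: eqP => // e; move: ij; rewrite e ltnn. Qed.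

Lemma lead_minor_toric_part (H : 'M[K]_m.+1) k : (k <= m.+1)%N -> strictly_lower H ->
  lead_minor (krylov H) k = lead_minor (krylov (toric_part H)) k.
Proof.
move=> km hH; have hT := @toric_part_lower H.
rewrite !lead_minor_lower //; try by move=> i j; exact: krylov_lower.
apply: eq_bigr => a _; rewrite !krylov_diag //.
rewrite [LHS]big_seq [RHS]big_seq; apply: eq_bigr => l.
by rewrite mem_index_iota mxE => /andP[_ lm]; rewrite !inordK ?eqxx // ltnW.
Qed.

Lemma lead_inv_toric k : (0 < k)%N -> (k <= m.+1)%N ->
  toric_invariant (lead_inv K m k).
Proof.
move=> k0 km; exists (lead_datum K k0 km).
  by move=> H [hH _]; rewrite !lead_datumE -lead_minor_toric_part.
by move=> N; rewrite lead_datumE.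
Qed.

Lemma toric_scale (c : K) f : c != 0 ->
  toric_invariant f -> @toric_invariant K m.+1 (c *: f).
Proof.
move=> c0 [P hP fP]; pose r := (\sum_i da P i)%N.
exists (datum_scale (r.-root c) P) => [H HH|N].
  by rewrite !datum_fun_scale hP.
by rewrite datum_fun_scale rootCK ?datum_size_gt0 // -fP.
Qed.

Lemma toric_tact f (t : torus K m.+1) :
  toric_invariant f -> exists c, tact t f = c *: f.
Proof.
move=> [P _ fP]; have [c hc] := datum_fun_conj P t.
exists c; apply: val_inj; apply/funext => N /=.
by rewrite /tact_fun fP hc -fP.
Qed.

(** The toric part of a strictly lower triangular matrix with subdiagonal v. *)
Definition tor_mx (v : 'I_m -> K) : 'M[K]_m.+1 :=
  \matrix_(i, j) oapp (fun l => (i == j.+1 :> nat)%:R * v l) 0 (insub (val j)).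

Lemma tor_mx_lower v : strictly_lower (tor_mx v).
Proof.
move=> i j ij; rewrite mxE; case: insubP => //= l _ _.
by rewrite ltn_eqF ?mul0r.
Qed.

Definition tor_nilp v : Defs.nilp K m.+1 := Sub _ (strictly_lower_nilp (tor_mx_lower v)).

Lemma tor_nilpE (H : nilp K m.+1) : in_HU (val H) ->
  tor_mx (subdiag (val H)) = toric_part (val H).
Proof.
move=> [hH _]; apply/matrixP => i j; rewrite !mxE.
case: insubP => /= [l _ le|]; last first.
  by rewrite -leqNgt => mj; case: eqP => // e; have := ltn_ord i; rewrite e ltnS ltnNge mj.
case: eqP => e; last by rewrite mul0r.
rewrite mul1r /subdiag; congr (val H _ _); apply/val_inj => /=; by rewrite ?e ?le.
Qed.

Lemma tor_nilp1 : tor_nilp (fun=> 1) = J.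
Proof.
apply: val_inj; apply/matrixP => i j /=; rewrite !mxE.
case: insubP => /= [l _ _|]; first by rewrite mulr1.
by rewrite -leqNgt => mj; case: eqP => // e; have := ltn_ord i; rewrite e ltnS ltnNge mj.
Qed.

Lemma tor_nilp_conj v (t : torus K m.+1) :
  nilp_conj (tdiag_unit t) (tor_nilp v) =
  tor_nilp (fun i => tcoord (root_char t) i * v i).
Proof.
apply: val_inj; apply/matrixP => i j /=; rewrite tdiag_conjE !mxE.
case: insubP => /= [l _ le|]; last by rewrite mulr0 mul0r.
case: eqP => e; last by rewrite !mul0r mulr0 mul0r.
rewrite !mul1r /tcoord mxE mulrAC; congr (_ / _ * _).
  by congr (tcoord t _); apply/val_inj; rewrite /= e le.
by congr (tcoord t _); apply/val_inj; rewrite /= le.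
Qed.

(** Toric invariants are determined by their values on these matrices
  ([toric_invariantE]), where they become polynomials in m variables. *)
Lemma tor_nilp_regular (f : inv_ring K m.+1) :
  exists q : {mpoly K[m]}, forall v, inv_fun f (tor_nilp v) = q.@[v].
Proof.
have [P fP] := inv_fun_regular f.
pose X : 'M[{mpoly K[m]}]_m.+1 :=
  \matrix_(i, j) oapp (fun l => (i == j.+1 :> nat)%:R * 'X_l) 0 (insub (val j)).
exists (P \mPo [tuple mxvec X 0 k | k < m.+1 * m.+1]) => v.
rewrite comp_mpoly_meval fP; apply: meval_eq => k; rewrite tnth_mktuple.
case/mxvec_indexP: k => i j; rewrite !mxvecE !mxE.
case: insubP => [l _ _|] /=; last by rewrite meval0.
by rewrite mevalM mevalXU rmorph_nat.
Qed.

Lemma root_section_neq0 (c : torus K m) (j : 'I_m.+1) :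
  \prod_(l < m | (l < j)%N) tcoord c l != 0.
Proof. by apply/prodf_neq0 => l _; exact: tcoord_neq0. Qed.

(** The section of the simple root characters with first coordinate 1. *)
Definition root_section (c : torus K m) : torus K m.+1 := mktorus (root_section_neq0 c).

Lemma root_sectionK c : root_char (root_section c) = c.
Proof.
apply: val_inj; apply/rowP => i; rewrite /= mxE /tcoord !mxE.
rewrite (bigD1 i) /= ?ltnSn //.
rewrite (eq_bigl (fun l : 'I_m => (l < i)%N)) ?mulfK //.
  by apply/prodf_neq0 => l _; exact: tcoord_neq0.
move=> l; rewrite ltnS [RHS]ltn_neqAle andbC; congr (_ && _).
Qed.

Lemma root_section1 : root_section (torus1 K m) = torus1 K m.+1.
Proof.
apply: val_inj; apply/rowP => i; rewrite !mxE big1 // => l _.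
by rewrite /tcoord mxE.
Qed.

Lemma root_section_mul c d :
  root_section (torus_mul c d) = torus_mul (root_section c) (root_section d).
Proof.
apply: val_inj; apply/rowP => i; rewrite !mxE /tcoord !mxE -big_split /=.
by apply: eq_bigr => l _; rewrite /tcoord !mxE.
Qed.

Lemma toric_invariantE f (H : nilp K m.+1) : toric_invariant f -> in_HU (val H) ->
  inv_fun f H = inv_fun f (tor_nilp (subdiag (val H))).
Proof. by move=> [P hP fP] HH; rewrite !fP hP //= tor_nilpE. Qed.

Lemma subdiag_torus (H : nilp K m.+1) : in_HU (val H) ->
  exists c : torus K m, forall i, tcoord c i = subdiag (val H) i.
Proof. by move=> [_ H0]; exists (mktorus H0) => i; rewrite /tcoord mxE. Qed.

(** Let q be the polynomial in m variables given by f on toric matrices. By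
  [toric_tact], rescaling the variables by c multiplies q by a scalar chi(c).
  Comparing coefficients at a single monomial a of q gives chi(c) = c^a, and q
  is recovered from its value at the point with all coordinates 1. *)
Lemma toric_monomial f : @toric_invariant K m.+1 f ->
  exists a : 'I_m -> nat, forall H : nilp K m.+1, in_HU (val H) ->
    inv_fun f H = inv_fun f J * \prod_i subdiag (val H) i ^+ a i.
Proof.
move=> fT; have [q qE] := tor_nilp_regular f.
pose chi (c : torus K m) a := \prod_(i < m) tcoord c i ^+ (a : 'X_{1..m}) i.
suff [a ha] : exists a : 'X_{1..m}, forall c : torus K m,
    q.@[tcoord c] = q.@[fun=> 1] * chi c a.
  exists a => H HH; have [c cE] := subdiag_torus HH.
  rewrite (toric_invariantE fT HH) -tor_nilp1 !qE.
  rewrite (meval_eq _ (v2 := tcoord c)) ?ha //.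
  by congr (_ * _); apply: eq_bigr => i _; rewrite cE.
have [->|q0] := eqVneq q 0.
  by exists 0%MM => c; rewrite !meval0 mul0r.
have [a aq] : exists a, a \in msupp q.
  exists (mlead q); exact: mlead_supp.
exists a => c.
have [x hx] := toric_tact (root_section c) fT.
have qx v : q.@[fun i => tcoord c i * v i] = x * q.@[v].
  have := congr1 (fun g => inv_fun g (tor_nilp v)) hx.
  rewrite /= /tact_fun tor_nilp_conj root_sectionK !qE. by move=> ->; rewrite -qE.
suff <- : x = chi c a.
  by rewrite mulrC -qx; apply: meval_eq => i; rewrite mulr1.
pose Q := q \mPo [tuple tcoord c i *: 'X_i | i < m].
have : Q - x *: q = 0.
  apply: mpoly_eq0_torus => v _; rewrite mevalB mevalZ comp_mpoly_meval -qx.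
  apply/eqP; rewrite subr_eq0; apply/eqP; apply: meval_eq => i.
  by rewrite tnth_mktuple mevalZ mevalXU.
move/(congr1 (mcoeff a)); rewrite mcoeffB mcoeffZ mcoeff0 => /eqP.
have -> : Q@_a = chi c a * q@_a.
  rewrite /Q comp_mpolyEX raddf_sum /= (bigD1_seq a) ?msupp_uniq //=.
  have E b : 'X_[b] \mPo [tuple tcoord c i *: 'X_i | i < m] = chi c b *: 'X_[b].
    rewrite comp_mpolyX [in RHS]mpolyXE_id -mul_mpolyC rmorph_prod -big_split /=.
    apply: eq_bigr => i _; rewrite tnth_mktuple exprZn -mul_mpolyC.
    by rewrite rmorphXn.
  rewrite E mcoeffZ mcoeffZ mcoeffX eqxx mulr1 mulrC big1 ?addr0 // => b ba.
  by rewrite E !mcoeffZ mcoeffX (negbTE ba) !mulr0.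
by rewrite -mulrBl mulf_eq0 subr_eq0 mcoeff_eq0 aq orbF => /eqP ->.
Qed.

(** The form needed to feed [toric_action], whose condition on weights concerns
  invariants equal to a monomial, not merely proportional to one. *)
Lemma toric_monomial1 f : @toric_invariant K m.+1 f ->
  (forall H, in_HU (val H) -> inv_fun f H = 0) \/
  exists2 a : 'I_m -> nat, inv_fun f J != 0 &
    toric_weight ((inv_fun f J)^-1 *: f) a /\ toric_invariant ((inv_fun f J)^-1 *: f).
Proof.
move=> fT; have [a ha] := toric_monomial fT.
have [f0|f0] := eqVneq (inv_fun f J) 0.
  by left => H HH; rewrite ha // f0 mul0r.
right; exists a => //; split; last by apply: toric_scale; rewrite ?invr_eq0.
by move=> H HH; rewrite -[LHS]/((inv_fun f J)^-1 * inv_fun f H) (ha H HH) mulKf.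
Qed.

End ToricInvariants.

(** * The toric ring, its torus action and the dense orbit *)

(** Points are bundled morphisms; their proof fields are propositions. *)
Lemma kpoint_eq (K : fieldType) (A : comAlgType K) (x y : kpoint A) : x =1 y -> x = y.
Proof.
case: x y => [x [[a] [b] [c]]] [y [[a'] [b'] [c']]] /= /funext e; subst y.
by rewrite (Prop_irrelevance a a') (Prop_irrelevance b b') (Prop_irrelevance c c').
Qed.

Section Evaluation.
Variables (K : fieldType) (n : nat) (N : nilp K n).

Definition inv_eval (f : inv_ring K n) : K := inv_fun f N.
Lemma inv_eval_zmod_morphism : zmod_morphism inv_eval. Proof. by []. Qed.
Lemma inv_eval_monoid_morphism : monoid_morphism inv_eval. Proof. by []. Qed.
Lemma inv_eval_scalable : scalable_for *%R inv_eval. Proof. by []. Qed.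
HB.instance Definition _ :=
  GRing.isZmodMorphism.Build (inv_ring K n) K inv_eval inv_eval_zmod_morphism.
HB.instance Definition _ :=
  GRing.isMonoidMorphism.Build (inv_ring K n) K inv_eval inv_eval_monoid_morphism.
HB.instance Definition _ :=
  GRing.isScalable.Build K (inv_ring K n) K *%R inv_eval inv_eval_scalable.

Definition eval_point : NmodU K n := inv_eval.
End Evaluation.

Section ToricRing.
Variables (K : numClosedFieldType) (m : nat).
Local Notation J := (jordan_nilp K m).
Local Notation A := (inv_ring K m.+1).
Local Notation B := (tor_ring K m.+1).

Lemma tor_ind (P : A -> Prop) :
  P 1 -> (forall c f g, P f -> P g -> P (c *: f + g)) ->
  (forall f g, P f -> P g -> P (f * g)) -> (forall f, toric_invariant f -> P f) ->
  forall b : B, P (tor_val b).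
Proof.
move=> h1 hl hM ht [f /= /asboolP hf].
apply/asboolP; apply: (hf (fun f => `[< P f >])).
  split; first exact/asboolP.
    by move=> c g h /asboolP Pg /asboolP Ph; apply/asboolP; exact: hl.
  by move=> g h /asboolP Pg /asboolP Ph; apply/asboolP; exact: hM.
by move=> g gT; apply/asboolP; exact: ht.
Qed.

Lemma toric_tor f : toric_invariant f -> f \in @tor_pred K m.+1.
Proof. by move=> fT; apply/asboolP => S _; apply. Qed.

Lemma tor_val_inj : injective (@tor_val K m.+1).
Proof. exact: val_inj. Qed.

(** Toricness passes from the generators to the whole toric ring. *)
Lemma tor_HU (b : B) (H : nilp K m.+1) : in_HU (val H) ->
  inv_fun (tor_val b) H = inv_fun (tor_val b) (tor_nilp (subdiag (val H))).
Proof.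
move=> HH; elim/tor_ind: (tor_val b) => //.
- by move=> c f g hf hg; rewrite -[LHS]/(c * inv_fun f H + inv_fun g H) hf hg.
- by move=> f g hf hg; rewrite -[LHS]/(inv_fun f H * inv_fun g H) hf hg.
- by move=> f fT; exact: toric_invariantE.
Qed.

Lemma tact_tor t (b : B) : tact t (tor_val b) \in @tor_pred K m.+1.
Proof.
elim/tor_ind: (tor_val b).
- by rewrite rmorph1 rpred1.
- by move=> c f g hf hg; rewrite linearP rpredD ?rpredZ.
- by move=> f g hf hg; rewrite rmorphM rpredM.
- by move=> f fT; have [c ->] := toric_tact t fT; rewrite rpredZ ?toric_tor.
Qed.

(** The action of T restricts to the toric ring by [toric_tact], and
  [root_section] turns it into an action of the torus of simple root
  characters. *)
Definition tor_act (c : torus K m) (b : B) : B := TorRing (tact_tor (root_section c) b).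

Lemma tor_act_zmod_morphism c : zmod_morphism (tor_act c).
Proof. by move=> f g; apply: val_inj; rewrite /= raddfB. Qed.
Lemma tor_act_monoid_morphism c : monoid_morphism (tor_act c).
Proof. by split=> [|f g]; apply: val_inj; rewrite /= ?rmorph1 ?rmorphM. Qed.
Lemma tor_act_scalable c : scalable (tor_act c).
Proof. by move=> d f; apply: val_inj; rewrite /= linearZ. Qed.
HB.instance Definition _ c :=
  GRing.isZmodMorphism.Build _ _ (tor_act c) (tor_act_zmod_morphism c).
HB.instance Definition _ c :=
  GRing.isMonoidMorphism.Build _ _ (tor_act c) (tor_act_monoid_morphism c).
HB.instance Definition _ c :=
  GRing.isScalable.Build K _ _ _ (tor_act c) (tor_act_scalable c).

Lemma tact1 (f : A) : tact (torus1 K m.+1) f = f.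
Proof.
apply: val_inj; apply/funext => N; rewrite /= /tact_fun; congr (inv_fun f _).
apply: val_inj; apply/matrixP => i j; rewrite /= tdiag_conjE.
by rewrite /tcoord !mxE mul1r divr1.
Qed.

Lemma tactM s t (f : A) : tact (torus_mul s t) f = tact s (tact t f).
Proof.
apply: val_inj; apply/funext => N; rewrite /= /tact_fun /= /tact_fun; congr (inv_fun f _).
apply: val_inj; apply/matrixP => i j; rewrite /= !tdiag_conjE.
rewrite /tcoord !mxE /tcoord invfM; ring.
Qed.

Lemma HU_conj (t : torus K m.+1) (H : nilp K m.+1) : in_HU (val H) ->
  in_HU (val (nilp_conj (tdiag_unit t) H)) /\
  forall i, subdiag (val (nilp_conj (tdiag_unit t) H)) i =
            tcoord (root_char t) i * subdiag (val H) i.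
Proof.
move=> [hH H0].
have E i : subdiag (val (nilp_conj (tdiag_unit t) H)) i =
            tcoord (root_char t) i * subdiag (val H) i.
  by rewrite /subdiag /= tdiag_conjE /tcoord mxE mulrAC.
split=> //; split=> [i j ij|i]; last by rewrite E mulf_neq0 ?tcoord_neq0.
by rewrite /= tdiag_conjE hH // mulr0 mul0r.
Qed.

Lemma tact_weight t (f : A) h : toric_weight f h ->
  tact t f = (\prod_i tcoord (root_char t) i ^+ h i) *: f.
Proof.
move=> fh; apply: inv_eq_HU => H HH; have [HH' sE] := HU_conj t HH.
rewrite -[LHS]/(inv_fun f _) -[RHS]/(_ * inv_fun f H) !fh // -big_split.
by apply: eq_bigr => i _; rewrite sE exprMn.
Qed.

Lemma toric_action_exists :
  @toric_action K m.+1 (fun c : torus K m => tor_act c : {lrmorphism B -> B}).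
Proof.
split=> [f|c d f|c f h fT fh]; apply: val_inj => /=.
- by rewrite root_section1 tact1.
- by rewrite root_section_mul tactM.
- by rewrite (tact_weight _ fh) root_sectionK.
Qed.

Section Action.
Variable act : torus K m -> {lrmorphism B -> B}.
Hypothesis act_toric : @toric_action K m.+1 act.

(** A torus action as required is unique: it is prescribed on generators that
  restrict to monomials, and by [toric_monomial1] these generate. *)
Lemma toric_actionE (c : torus K m) (t : torus K m.+1) (b : B) :
  root_char t = c -> tor_val (act c b) = tact t (tor_val b).
Proof.
move=> tc.
suff [b' e e'] : exists2 b', tor_val b' = tor_val b & tor_val (act c b') = tact t (tor_val b).
  by rewrite -(tor_val_inj e) e' e.
elim/tor_ind: (tor_val b) => [|d f g [u uf uf'] [v vg vg']|f g [u uf uf'] [v vg vg']|f fT].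
- by exists 1; rewrite ?rmorph1.
- by exists (d *: u + v); rewrite !linearP /= ?uf ?vg ?uf' ?vg'.
- by exists (u * v); rewrite !rmorphM /= ?uf ?vg ?uf' ?vg'.
have [f0|[a f0 [fa fT1]]] := toric_monomial1 fT.
  have -> : f = 0 by apply: inv_eq_HU => H HH; rewrite f0.
  by exists 0; rewrite ?raddf0.
set l := inv_fun f J in f0 fa fT1.
pose T : B := TorRing (toric_tor fT1).
have aT : act c T = (\prod_i tcoord c i ^+ a i) *: T.
  by have [_ _ act_w] := act_toric; apply: act_w; [exact: fT1|exact: fa].
have fE : f = l *: tor_val T by rewrite /= scalerA mulfV // scale1r.
exists (l *: T); first by rewrite [RHS]fE.
have -> : act c (l *: T) = l *: act c T by exact: linearZ.
by rewrite aT [in RHS]fE [RHS]linearZ /= (tact_weight t fa) tc.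
Qed.

(** The orbit of the shift matrix consists of the toric matrices with nonzero
  subdiagonal. *)
Lemma orbit_eval (c : torus K m) (b : B) :
  spec_map (act c) (tor_map (eval_point J)) b = inv_fun (tor_val b) (tor_nilp (tcoord c)).
Proof.
rewrite -[LHS]/(inv_fun (tor_val (act c b)) J) (toric_actionE b (root_sectionK c)) /=.
rewrite /tact_fun -tor_nilp1 tor_nilp_conj root_sectionK; congr (inv_fun _ (tor_nilp _)).
by apply/funext => i; rewrite mulr1.
Qed.

End Action.

Lemma tor_nilp_HU (c : torus K m) : in_HU (val (tor_nilp (tcoord c))) /\
  forall i, subdiag (val (tor_nilp (tcoord c))) i = tcoord c i.
Proof.
have E i : subdiag (val (tor_nilp (tcoord c))) i = tcoord c i.
  rewrite /subdiag mxE /=; case: insubP => [l _ le|]; last by rewrite /= ltn_ord.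
  by rewrite /= eqxx mul1r; congr (tcoord c _); apply/val_inj.
by split=> //; split=> [|i]; [exact: tor_mx_lower|rewrite E tcoord_neq0].
Qed.

Lemma lead_inv_tor k : lead_inv K m k \in @tor_pred K m.+1.
Proof.
case: k => [|k].
  suff -> : lead_inv K m 0 = 1 by rewrite rpred1.
  by apply: val_inj; apply/funext => N; exact: det_mx00.
case: (leqP k.+1 m.+1) => km; first exact/toric_tor/lead_inv_toric.
suff -> : lead_inv K m k.+1 = 0 by rewrite rpred0.
by apply: val_inj; apply/funext => N; exact: left_minor_big.
Qed.

Definition lead_tor k : B := TorRing (lead_inv_tor k).

(** Consecutive diagonal entries of the Krylov matrix differ by the factor x_i,
  and consecutive leading minors by a diagonal entry. *)
Lemma lead_inv_recE (H : nilp K m.+1) (i : 'I_m) : strictly_lower (val H) ->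
  subdiag (val H) i * (inv_fun (lead_inv K m i) H * inv_fun (lead_inv K m i.+2) H) =
  inv_fun (lead_inv K m i.+1) H ^+ 2.
Proof.
move=> hH; have im := ltn_ord i.
rewrite [inv_fun (lead_inv _ _ i) H]lead_minor_lower; [|by move=> *; exact: krylov_lower|lia].
rewrite [inv_fun (lead_inv _ _ i.+1) H]lead_minor_lower; [|by move=> *; exact: krylov_lower|lia].
rewrite [inv_fun (lead_inv _ _ i.+2) H]lead_minor_lower; [|by move=> *; exact: krylov_lower|lia].
rewrite !big_ord_recr /=.
have -> : krylov (val H) (inord i) (inord i) =
    subdiag (val H) i * krylov (val H) (inord i.+1) (inord i.+1).
  rewrite !krylov_diag // !inordK; [|lia|lia].
  rewrite big_ltn //; congr (val H _ _ * _); apply/val_inj; rewrite /= inordK //; lia.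
by ring.
Qed.

(** The leading minors generate the full lattice of weights, so the coordinates
  of the torus are quotients of toric invariants. *)
Lemma tcoord_lead (c : torus K m) (i : 'I_m)
  (g := fun k => inv_fun (lead_inv K m k) (tor_nilp (tcoord c))) :
  g i * g i.+2 != 0 /\ tcoord c i = g i.+1 ^+ 2 / (g i * g i.+2).
Proof.
have [HH sE] := tor_nilp_HU c; have im := ltn_ord i.
have h : g i * g i.+2 != 0 by rewrite mulf_neq0 // lead_inv_HU_neq0 //; lia.
split=> //; have [hH _] := HH.
by rewrite -(lead_inv_recE i hH) sE mulfK.
Qed.

(** Evaluations at nilpotent matrices already separate the elements of the
  toric ring. *)
Lemma tor_incl_dominant : dominant (tor_incl K m.+1).
Proof.
move=> Z [S ->] YZ; apply/seteqP; split=> // x _ f Sf.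
suff -> : f = 0 by rewrite raddf0.
apply: tor_val_inj; apply: val_inj; apply/funext => N.
have := YZ (tor_map (eval_point N)) (ex_intro2 _ _ (eval_point N) Logic.I erefl) f Sf.
by [].
Qed.

Section Orbit.
Variable act : torus K m -> {lrmorphism B -> B}.
Hypothesis act_toric : @toric_action K m.+1 act.

Lemma tor_map_equivariant (t : torus K m.+1) (y : NmodU K m.+1) :
  tor_map (spec_map (tact t) y) = spec_map (act (root_char t)) (tor_map y).
Proof.
apply: kpoint_eq => b; rewrite -[LHS]/(y (tact t (tor_val b))).
by rewrite -[RHS]/(y (tor_val (act _ b))) (toric_actionE act_toric b (erefl (root_char t))).
Qed.

Definition orbit_map (c : torus K m) : toric_variety K m.+1 :=
  spec_map (act c) (tor_map (eval_point J)).

Lemma orbit_map_iso : torus_iso orbit_map (range orbit_map).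
Proof.
have psiE c b : orbit_map c b = inv_fun (tor_val b) (tor_nilp (tcoord c)).
  exact: orbit_eval.
split=> //.
- move=> c d cd; apply: val_inj; apply/rowP => i.
  rewrite -[LHS]/(tcoord c i) -[RHS]/(tcoord d i).
  have E k : inv_fun (lead_inv K m k) (tor_nilp (tcoord c)) =
      inv_fun (lead_inv K m k) (tor_nilp (tcoord d)).
    by rewrite -[LHS](psiE c (lead_tor k)) -[RHS](psiE d (lead_tor k)) cd.
  by rewrite (tcoord_lead c i).2 (tcoord_lead d i).2 !E.
- move=> f; have [q qE] := tor_nilp_regular (tor_val f).
  by exists q, 0%N => c; rewrite psiE qE expr0 divr1.
- move=> i; exists (lead_tor i.+1 ^+ 2), (lead_tor i * lead_tor i.+2) => c.
  by rewrite !psiE; exact: tcoord_lead.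
Qed.

Lemma orbit_map_dense : dense_orbit act (range orbit_map).
Proof.
split; first by exists (tor_map (eval_point J)).
move=> Z [S ->] YZ; apply/seteqP; split=> // x _ f Sf.
suff -> : f = 0 by rewrite raddf0.
apply: tor_val_inj; apply: inv_eq_HU => H HH.
rewrite (tor_HU f HH); have [c cE] := subdiag_torus HH.
have := YZ (orbit_map c) (ex_intro2 _ _ c Logic.I erefl) f Sf.
rewrite /orbit_map orbit_eval // => e.
by rewrite -[RHS]e; congr (inv_fun _ (tor_nilp _)); apply/funext => i; rewrite cE.
Qed.

(** The torus scales G_k by nonzero factors, so if G_k vanished at one point of
  the orbit it would vanish on the whole orbit, hence everywhere by density;
  but it does not vanish at the shift matrix. *)
Lemma dense_orbit_lead_neq0 X x k : dense_orbit act X -> X x -> (k <= m.+1)%N ->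
  x (lead_tor k) != 0.
Proof.
move=> [[x0 ->] dX] [c _ <-] km.
have hd e : exists2 d, d != 0 & act e (lead_tor k) = d *: lead_tor k.
  have [d hd] : exists d, tact (root_section e) (lead_inv K m k) = d *: lead_inv K m k.
    case: k km => [|k] km; last exact/toric_tact/lead_inv_toric.
    exists 1; rewrite scale1r (_ : lead_inv K m 0 = 1) ?rmorph1 //.
    by apply: val_inj; apply/funext => N; exact: det_mx00.
  exists d.
    apply/eqP => d0; have [JH _] := HU_conj (root_section e) (jordan_in_HU K m).
    have /eqP[] := lead_inv_HU_neq0 JH km.
    by have := congr1 (fun g => inv_fun g J) hd; rewrite d0 scale0r.
  apply: tor_val_inj.
  by rewrite (toric_actionE act_toric _ (root_sectionK e)) /= hd.
have xE (e : torus K m) d : act e (lead_tor k) = d *: lead_tor k ->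
    spec_map (act e) x0 (lead_tor k) = d * x0 (lead_tor k).
  by move=> ae; rewrite -[LHS]/(x0 (act e (lead_tor k))) ae; exact: linearZ.
have [d d0 dE] := hd c; rewrite (xE _ _ dE) mulf_neq0 //; apply/eqP => e0.
(* the zero set of G_k contains the orbit, hence is everything *)
pose Z := [set x : kpoint B | forall f, [set lead_tor k] f -> x f = 0].
have ZT : Z = setT.
  apply: dX; first by exists [set lead_tor k].
  move=> _ [e _ <-] _ ->; have [d' _ d'E] := hd e.
  by rewrite (xE _ _ d'E) e0 mulr0.
have : Z (tor_map (eval_point J)) by rewrite ZT.
move=> /(_ _ erefl); apply/eqP.
exact: (lead_inv_HU_neq0 (jordan_in_HU K m) km).
Qed.
End Orbit.
End ToricRing.

(** * Extending functions from H_U to invariants *)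

(** Unlike induction on monomials, this suits properties that are only known to
  respect the ring operations. *)
Lemma mpoly_ring_ind (R : comNzRingType) k (P : {mpoly R[k]} -> Prop) :
  (forall c, P c%:MP) -> (forall i, P 'X_i) ->
  (forall p q, P p -> P q -> P (p + q)) -> (forall p q, P p -> P q -> P (p * q)) ->
  forall p, P p.
Proof.
move=> hC hX hD hM p; rewrite (mpolyE p).
apply: (big_ind P) => [||a _]; [exact: (hC 0)|exact: hD|].
rewrite -mul_mpolyC mpolyXE_id; apply: (hM) => //.
apply: (big_ind P) => [||i _]; [exact: (hC 1)|exact: hM|].
by elim: (a i) => [|d IH]; [exact: (hC 1)|rewrite exprS; exact: hM].
Qed.

Section Localization.
Variables (K : numClosedFieldType) (m : nat).
Local Notation A := (inv_ring K m.+1).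
Local Notation B := (tor_ring K m.+1).
Local Notation N := (nilp K m.+1).
Local Notation F := (lead_prod K m).
Local Notation G := (lead_inv K m).

(** Functions on H_U that lie in the localization of K[N]^U at [lead_prod]. *)
Definition extends_to_inv (phi : N -> K) : Prop :=
  exists M (a : A), forall H : N, in_HU (val H) ->
    inv_fun a H = inv_fun F H ^+ M * phi H.

Lemma inv_funX (f : A) d (H : N) : inv_fun (f ^+ d) H = inv_fun f H ^+ d.
Proof. exact: (rmorphXn (inv_eval H : {rmorphism A -> K})). Qed.

Lemma extends_ext phi psi : (forall H, in_HU (val H) -> phi H = psi H) ->
  extends_to_inv phi -> extends_to_inv psi.
Proof. by move=> e [M [a ha]]; exists M, a => H HH; rewrite ha // e. Qed.

Lemma extends_inv (a : A) : extends_to_inv (inv_fun a).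
Proof. by exists 0%N, a => H _; rewrite expr0 mul1r. Qed.

Lemma extends_mul phi psi : extends_to_inv phi -> extends_to_inv psi ->
  extends_to_inv (fun H => phi H * psi H).
Proof.
move=> [M [a ha]] [M' [b hb]]; exists (M + M')%N, (a * b) => H HH.
by rewrite -[LHS]/(inv_fun a H * inv_fun b H) ha // hb // exprD; ring.
Qed.

Lemma extends_sub phi psi : extends_to_inv phi -> extends_to_inv psi ->
  extends_to_inv (fun H => phi H - psi H).
Proof.
move=> [M [a ha]] [M' [b hb]].
exists (M + M')%N, (F ^+ M' * a - F ^+ M * b) => H HH.
rewrite -[LHS]/(inv_fun (F ^+ M') H * inv_fun a H - inv_fun (F ^+ M) H * inv_fun b H).
by rewrite !inv_funX ha // hb // exprD; ring.
Qed.

Lemma extends_sum (I : finType) (P : pred I) (phi : I -> N -> K) :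
  (forall i, P i -> extends_to_inv (phi i)) ->
  extends_to_inv (fun H => \sum_(i | P i) phi i H).
Proof.
move=> h; elim: (index_enum I) => [|i s IH].
  apply: extends_ext (extends_inv 0) => H _; by rewrite big_nil.
have h0 : extends_to_inv (fun H => inv_fun (0 : A) H - \sum_(j <- s | P j) phi j H).
  by apply: extends_sub => //; exact: extends_inv.
have [Pi|Pi] := boolP (P i); last first.
  by apply: extends_ext IH => H _; rewrite big_cons (negbTE Pi).
apply: extends_ext (extends_sub (h i Pi) h0) => H _.
by rewrite big_cons Pi -[inv_fun 0 H]/(0 : K) sub0r opprK.
Qed.

Definition lead_cofactor k : B := \prod_(l < m.+2 | l != k :> nat) lead_tor K m l.

Lemma lead_cofactorE k (H : N) : (k <= m.+1)%N ->
  inv_fun F H = inv_fun (G k) H * inv_fun (tor_val (lead_cofactor k)) H.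
Proof.
move=> km; rewrite inv_fun_prod (bigD1 (Ordinal (km : (k < m.+2)%N))) //=.
congr (_ * _); rewrite (big_morph _ (rmorphM (@tor_val K m.+1)) (rmorph1 _)).
by rewrite inv_fun_prod.
Qed.

Lemma extends_lead_inv k : (k <= m.+1)%N ->
  extends_to_inv (fun H => (inv_fun (G k) H)^-1).
Proof.
move=> km; exists 1%N, (tor_val (lead_cofactor k)) => H HH.
by rewrite expr1 (lead_cofactorE H km) mulrC mulKf // lead_inv_HU_neq0.
Qed.

Lemma extends_krylov i j : extends_to_inv (fun H => krylov (val H) i j).
Proof.
have jm := ltnW (ltn_ord j).
apply: extends_ext (extends_mul (extends_inv (bordered_inv K i j)) (extends_lead_inv jm)).
move=> H HH; have [hH _] := HH.
rewrite [inv_fun (bordered_inv _ _ _) H]bordered_minor_lower.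
  by rewrite mulrC mulKf //; exact: lead_inv_HU_neq0.
by move=> *; exact: krylov_lower.
Qed.

Lemma krylov_diag_lead (H : N) (i : 'I_m.+1) : strictly_lower (val H) ->
  inv_fun (G i.+1) H = inv_fun (G i) H * krylov (val H) i i.
Proof.
move=> hH; have im := ltn_ord i.
rewrite [inv_fun (G i) H]lead_minor_lower; [|by move=> *; exact: krylov_lower|lia].
rewrite [inv_fun (G i.+1) H]lead_minor_lower; [|by move=> *; exact: krylov_lower|lia].
by rewrite big_ord_recr /= inord_val.
Qed.

(** Row i of the relation [krylov_shift] expresses row i of H by entries of the
  Krylov matrix and the rows of H above it; only the diagonal entry of the
  Krylov matrix has to be inverted, and it is a quotient of leading minors. *)
Lemma extends_entry i j : extends_to_inv (fun H => val H i j).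
Proof.
have [k] := ubnP (nat_of_ord i); elim: k i j => // k IH i j ik.
have im := ltn_ord i.
pose S (H : N) := if i == ord0 then 0 else krylov (val H) (inord i.-1) j.
have hS : extends_to_inv S.
  rewrite /S; case: eqP => _; last exact: extends_krylov.
  by apply: (@extends_ext (inv_fun (0 : A))) => //; exact: extends_inv.
have hsum : extends_to_inv (fun H =>
    \sum_(l < m.+1 | (l < i)%N) krylov (val H) i l * val H l j).
  apply: extends_sum => l li; apply: extends_mul; first exact: extends_krylov.
  by apply: IH; lia.
have hdiag : extends_to_inv (fun H => (krylov (val H) i i)^-1).
  apply: extends_ext (extends_mul (extends_inv (G i)) (extends_lead_inv (ltn_ord i))).
  move=> H HH; have [hH _] := HH; rewrite krylov_diag_lead //.
  have := lead_inv_HU_neq0 HH (ltn_ord i); rewrite krylov_diag_lead // mulf_eq0 negb_or.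
  by move=> /andP[g0 k0]; rewrite invfM mulVKf.
apply: extends_ext (extends_mul hdiag (extends_sub hS hsum)) => H HH; have [hH _] := HH.
have k0 : krylov (val H) i i != 0.
  have := lead_inv_HU_neq0 HH (ltn_ord i); rewrite krylov_diag_lead // mulf_eq0 negb_or.
  by move=> /andP[].
have E : (krylov (val H) *m val H) i j = krylov (val H) i i * val H i j +
    \sum_(l < m.+1 | (l < i)%N) krylov (val H) i l * val H l j.
  rewrite mxE (bigD1 i) //= (bigID (fun l : 'I_m.+1 => (l < i)%N)) /=.
  rewrite [X in _ + (_ + X)]big1 => [|l]; last first.
    move=> /andP[li]; rewrite -leqNgt leq_eqVlt => /orP[/eqP/val_inj e|il].
      by rewrite e eqxx in li.
    by rewrite krylov_lower ?mul0r.
  rewrite addr0; congr (_ + _); apply: eq_bigl => l.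
  by rewrite andb_idl // => li; apply/eqP => e; rewrite e ltnn in li.
by rewrite /S -(krylov_shift i j (nilp_expS (valP H))) E addrK mulKf.
Qed.

End Localization.

(** * Fibres over the dense orbit *)

Section FibreMorphism.
Variables (K : fieldType) (A B : comAlgType K) (phi : {lrmorphism B -> A}) (x : kpoint B).

Lemma fibre_pi_zmod_morphism : zmod_morphism (@fibre_pi K A B phi x).
Proof. exact: (raddfB (\pi_(Quotient.quot (fibre_ideal phi x)))%qT). Qed.
Lemma fibre_pi_monoid_morphism : monoid_morphism (@fibre_pi K A B phi x).
Proof. by split=> // f g; exact: fibre_piM. Qed.
HB.instance Definition _ :=
  GRing.isZmodMorphism.Build A (fibre_ring phi x) (@fibre_pi K A B phi x)
    fibre_pi_zmod_morphism.
HB.instance Definition _ :=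
  GRing.isMonoidMorphism.Build A (fibre_ring phi x) (@fibre_pi K A B phi x)
    fibre_pi_monoid_morphism.

Lemma kpoint_alg (k : K) : x k%:A = k.
Proof. by rewrite -[RHS]mulr1 -(rmorph1 x); exact: linearZ. Qed.

(** Elements of the base ring become constants on the fibre. *)
Lemma fibre_pi_phi (b : B) : fibre_pi phi x (phi b) = fibre_pi phi x (x b)%:A.
Proof.
apply/fibre_piP/asboolP; exists [:: (1, b - (x b)%:A)].
  move=> g; rewrite inE => /eqP -> /=; rewrite raddfB.
  by apply/eqP; rewrite subr_eq0 eq_sym; apply/eqP; exact: kpoint_alg.
rewrite big_seq1 /= mul1r raddfB; congr (_ - _).
by rewrite -(rmorph1 phi); apply/esym; exact: linearZ.
Qed.

End FibreMorphism.

Section Slots.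
Variable m : nat.

Definition far_pair : Type := {p : 'I_m.+1 * 'I_m.+1 | (p.2.+1 < p.1)%N}.
HB.instance Definition _ := Finite.on far_pair.

(** Row i >= 1 contains i - 1 positions below the subdiagonal. *)
Lemma card_far_pair : #|{: far_pair}| = (((m.+1 - 1) * (m.+1 - 2)) %/ 2)%N.
Proof.
rewrite card_sig -sum1_card.
rewrite -(pair_big_dep xpredT (fun i j : 'I_m.+1 => (j.+1 < i)%N) (fun _ _ => 1%N)) /=.
rewrite subSS subn0 -[(m.+1 - 2)%N]/(m - 1)%N subn1 divn2 -bin2 -bin2_sum big_mkord.
rewrite big_ord_recl /= big1 ?add0n //; apply: eq_bigr => i _.
rewrite /bump /= add1n sum1_card.
have im : (i <= m.+1)%N by have := ltn_ord i; lia.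
rewrite (eq_card (B := [pred j : 'I_m.+1 | (j < i)%N])) //.
by rewrite -sum1_card (big_ord_narrow im) sum1_card card_ord.
Qed.

(** [slot] numbers the positions below the subdiagonal, so that the polynomial
  ring in D variables has one variable for each. *)
Definition slot (p : far_pair) : 'I_(((m.+1 - 1) * (m.+1 - 2)) %/ 2) :=
  cast_ord card_far_pair (enum_rank p).

Definition slot_pair (s : 'I_(((m.+1 - 1) * (m.+1 - 2)) %/ 2)) : far_pair :=
  enum_val (cast_ord (esym card_far_pair) s).

Lemma slotK : cancel slot slot_pair.
Proof. by move=> p; rewrite /slot_pair cast_ordK enum_rankK. Qed.

Lemma slot_pairK : cancel slot_pair slot.
Proof. by move=> s; rewrite /slot /slot_pair enum_valK cast_ordKV. Qed.

(** The matrix of H_U with subdiagonal c and entries y below it; its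
  coefficients may be taken in a polynomial ring, as in [generic_slice]. *)
Definition slice_mx (R : comNzRingType) (c : 'I_m -> R) y : 'M[R]_m.+1 :=
  \matrix_(i, j) if (i == j.+1 :> nat) then oapp c 0 (insub (val j))
                 else oapp (fun p : far_pair => y (slot p)) 0 (insub (i, j)).

Lemma slice_mx_lower (R : comNzRingType) (c : 'I_m -> R) y :
  strictly_lower (slice_mx c y).
Proof.
move=> i j ij; rewrite mxE ltn_eqF // insubN //= -leqNgt.
by rewrite (leq_trans ij) // leqW.
Qed.

Lemma slice_mx_far (R : comNzRingType) (c : 'I_m -> R) y (p : far_pair) :
  slice_mx c y (val p).1 (val p).2 = y (slot p).
Proof.
rewrite mxE -surjective_pairing valK /= gtn_eqF //.
by case: p => p /= ->.
Qed.

Lemma subdiag_slice (K : fieldType) (c : 'I_m -> K) y i :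
  subdiag (slice_mx c y) i = c i.
Proof.
rewrite /subdiag mxE /= eqxx; case: insubP => [l _ le|]; last by rewrite /= ltn_ord.
by rewrite /=; congr c; apply/val_inj.
Qed.

End Slots.

Section Fibre.
Variables (K : numClosedFieldType) (m : nat).
Local Notation A := (inv_ring K m.+1).
Local Notation B := (tor_ring K m.+1).
Local Notation N := (nilp K m.+1).
Local Notation F := (lead_prod K m).
Local Notation D := (((m.+1 - 1) * (m.+1 - 2)) %/ 2)%N.
Variable x : kpoint B.
Hypothesis x_lead : forall k, (k <= m.+1)%N -> x (lead_tor K m k) != 0.

Let g k := x (lead_tor K m k).

Lemma fibre_coord_neq0 (i : 'I_m) : g i.+1 ^+ 2 / (g i * g i.+2) != 0.
Proof.
have im := ltn_ord i.
by rewrite mulf_neq0 ?invr_eq0 ?mulf_neq0 ?expf_neq0 ?x_lead //; lia.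
Qed.

(** The subdiagonal over x, read off from the leading minors as in
  [tcoord_lead]. *)
Definition fibre_coord : torus K m := mktorus fibre_coord_neq0.
Let c := fibre_coord.

(** A point where no leading minor vanishes is determined by its values there:
  a toric invariant with weight a satisfies a monomial identity with the
  leading minors, obtained from [lead_inv_recE], and x respects it. *)
Lemma kpoint_tor (b : B) : x b = inv_fun (tor_val b) (tor_nilp (tcoord c)).
Proof.
pose N0 := tor_nilp (tcoord c).
suff [b' e e'] : exists2 b', tor_val b' = tor_val b & x b' = inv_fun (tor_val b) N0.
  by rewrite -(tor_val_inj e) e' e.
elim/tor_ind: (tor_val b) => [|d f h [u uf uf'] [v vh vh']|f h [u uf uf'] [v vh vh']|f fT].
- by exists 1; rewrite ?rmorph1.
- by exists (d *: u + v); rewrite !linearP /= ?uf ?vh ?uf' ?vh'.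
- by exists (u * v); rewrite !rmorphM /= ?uf ?vh ?uf' ?vh'.
have [f0|[a f0 [fa fT1]]] := toric_monomial1 fT.
  have -> : f = 0 by apply: inv_eq_HU => H HH; rewrite f0.
  by exists 0; rewrite ?raddf0.
set l := inv_fun f (jordan_nilp K m) in f0 fa fT1.
pose T : B := TorRing (toric_tor fT1).
have fE : f = l *: tor_val T by rewrite /= scalerA mulfV // scale1r.
exists (l *: T); first by rewrite [RHS]fE.
have -> : x (l *: T) = l * x T by exact: linearZ.
rewrite [in RHS]fE -[RHS]/(l * inv_fun (tor_val T) N0); congr (_ * _).
have [HH sE] := tor_nilp_HU c.
rewrite [RHS]fa //.
pose G := lead_tor K m.
have : T * \prod_(i < m) (G i * G i.+2) ^+ a i = \prod_(i < m) (G i.+1 ^+ 2) ^+ a i.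
  apply: tor_val_inj; apply: inv_eq_HU => H [hH H0].
  rewrite rmorphM -[LHS]/(inv_fun (tor_val T) H * inv_fun (tor_val _) H) fa //.
  rewrite !(big_morph _ (rmorphM (@tor_val K m.+1)) (rmorph1 _)) !inv_fun_prod.
  rewrite -big_split /=; apply: eq_bigr => i _.
  by rewrite !rmorphXn !inv_funX -(lead_inv_recE i hH) [RHS]exprMn.
move/(congr1 x); rewrite rmorphM !rmorph_prod.
under eq_bigr do rewrite rmorphXn rmorphM -/(g _).
under [in RHS]eq_bigr do rewrite !rmorphXn -/(g _).
move=> E.
have P0 : \prod_(i < m) (g i * g i.+2) ^+ a i != 0.
  apply/prodf_neq0 => i _; have im := ltn_ord i.
  by rewrite expf_neq0 // mulf_neq0 // x_lead //; lia.
apply: (mulIf P0); rewrite [LHS]E -big_split /=; apply: eq_bigr => i _.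
have im := ltn_ord i.
by rewrite sE /tcoord mxE -exprMn divfK // mulf_neq0 // x_lead //; lia.
Qed.


Definition slice_nilp (y : 'I_D -> K) : N :=
  Sub _ (strictly_lower_nilp (slice_mx_lower (tcoord c) y)).

Lemma slice_nilp_HU y : in_HU (val (slice_nilp y)).
Proof. by split=> [|i]; [exact: slice_mx_lower|rewrite subdiag_slice tcoord_neq0]. Qed.

Lemma kpoint_slice (b : B) y : inv_fun (tor_val b) (slice_nilp y) = x b.
Proof.
rewrite (tor_HU b (slice_nilp_HU y)) kpoint_tor; congr (inv_fun _ (tor_nilp _)).
by apply/funext => i; rewrite subdiag_slice.
Qed.

Definition generic_slice : 'M[{mpoly K[D]}]_m.+1 :=
  slice_mx (fun i => (tcoord c i)%:MP) (fun s => 'X_s).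

Definition restrict (P : {mpoly K[m.+1 * m.+1]}) : {mpoly K[D]} :=
  P \mPo [tuple mxvec generic_slice 0 k | k < m.+1 * m.+1].

Lemma restrictE P y : (restrict P).@[y] = P.@[fun k => mxvec (val (slice_nilp y)) 0 k].
Proof.
rewrite comp_mpoly_meval; apply: meval_eq => k; rewrite tnth_mktuple.
case/mxvec_indexP: k => i j; rewrite !mxvecE !mxE.
case: eqP => _; case: insubP => [l _ _|] /=; by rewrite ?meval0 ?mevalC ?mevalXU.
Qed.

Lemma mpoly_eq_eval k (p q : {mpoly K[k]}) : (forall y, p.@[y] = q.@[y]) -> p = q.
Proof.
move=> pq; apply/eqP; rewrite -subr_eq0; apply/eqP; apply: mpoly_eq0_torus => v _.
by rewrite mevalB pq subrr.
Qed.

(** A polynomial representing f is chosen, but its restriction to the slice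
  depends on f only, see [slice_polyE]. *)
Definition slice_poly (f : A) : {mpoly K[D]} :=
  restrict (projT1 (cid (inv_fun_regular f))).

Lemma slice_polyE f y : (slice_poly f).@[y] = inv_fun f (slice_nilp y).
Proof. by rewrite restrictE; case: cid. Qed.

Local Notation pi := (fibre_pi (tor_incl K m.+1) x).
Local Notation Q := (fibre_ring (tor_incl K m.+1) x).

(** By [kpoint_slice], elements of the kernel of x vanish on the slice. *)
Lemma slice_poly_ideal f h : pi f = pi h -> slice_poly f = slice_poly h.
Proof.
move=> /fibre_piP/asboolP[s hs fh]; apply: mpoly_eq_eval => y; rewrite !slice_polyE.
apply/eqP; rewrite -subr_eq0; apply/eqP.
rewrite -[LHS]/(inv_eval (slice_nilp y) (f - h)) fh raddf_sum big_seq big1 // => b bs.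
by rewrite -[LHS]/(inv_fun b.1 _ * inv_fun (tor_val b.2) _) kpoint_slice hs ?mulr0.
Qed.

Definition lead_prod_tor : B := \prod_(k < m.+2) lead_tor K m k.

Lemma lead_prod_torE : tor_val lead_prod_tor = F.
Proof. by rewrite (big_morph _ (rmorphM (@tor_val K m.+1)) (rmorph1 _)). Qed.

Let gamma := x lead_prod_tor.

Lemma gamma_neq0 : gamma != 0.
Proof. by rewrite /gamma rmorph_prod; apply/prodf_neq0 => k _; rewrite x_lead // -ltnS. Qed.

Lemma lead_prod_slice y : inv_fun F (slice_nilp y) = gamma.
Proof. by rewrite -lead_prod_torE kpoint_slice. Qed.

(** [extends_entry] extends an entry times a power of [lead_prod]; on the slice
  the latter is the nonzero constant gamma and can be divided out. *)
Lemma slot_lifting (s : 'I_D) : exists Y : A,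
  (forall y, inv_fun Y (slice_nilp y) = y s) /\
  exists M a, (forall H : N, in_HU (val H) -> inv_fun a H =
      inv_fun F H ^+ M * val H (val (slot_pair s)).1 (val (slot_pair s)).2) /\
    a = gamma ^+ M *: Y.
Proof.
have [M [a ha]] := @extends_entry K m (val (slot_pair s)).1 (val (slot_pair s)).2.
have g0 : gamma ^+ M != 0 by rewrite expf_neq0 ?gamma_neq0.
exists ((gamma ^+ M)^-1 *: a); split.
  move=> y; rewrite -[LHS]/(_ * inv_fun a _) ha; last exact: slice_nilp_HU.
  by rewrite lead_prod_slice mulKf // slice_mx_far slot_pairK.
by exists M, a; split=> //; rewrite scalerA mulfV // scale1r.
Qed.

Definition coord_lift (s : 'I_D) : A := projT1 (cid (slot_lifting s)).

(** The candidate inverse of [slice_poly]. *)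
Definition lift_poly (p : {mpoly K[D]}) : A := mmap (in_alg A) coord_lift p.

Lemma lift_poly_eval p (H : N) : inv_fun (lift_poly p) H = p.@[fun s => inv_fun (coord_lift s) H].
Proof.
rewrite -[LHS]/(inv_eval H _) raddf_sum mevalE; apply: eq_bigr => a _.
rewrite -[LHS]/((p@_a * 1) * inv_fun (mmap1 coord_lift a) H) mulr1 inv_fun_prod.
by congr (_ * _); apply: eq_bigr => i _; rewrite inv_funX.
Qed.

Lemma slice_lift_poly p : slice_poly (lift_poly p) = p.
Proof.
apply: mpoly_eq_eval => y; rewrite slice_polyE lift_poly_eval; apply: meval_eq => s.
by rewrite /coord_lift; case: cid => Y [].
Qed.

Lemma pi_alg (k : K) (f : A) : pi (k *: f) = pi k%:A * pi f.
Proof. by rewrite -rmorphM /= -scalerAl mul1r. Qed.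

Lemma pi_lead_prod : pi F = pi gamma%:A.
Proof. by rewrite -lead_prod_torE; exact: fibre_pi_phi. Qed.

(** A polynomial P in the matrix entries need not be invariant, but some multiple
  by a power of [lead_prod] agrees on H_U with an invariant a. The second
  condition says that on the fibre a is this multiple of the lift of the
  restriction of P to the slice. Stated in this way the property is respected
  by sums and products. *)
Definition lifts_restriction P : Prop := exists M (a : A),
  (forall H : N, in_HU (val H) ->
     inv_fun a H = inv_fun F H ^+ M * P.@[fun k => mxvec (val H) 0 k]) /\
  pi a = pi F ^+ M * pi (lift_poly (restrict P)).

Lemma lifts_restriction_all P : lifts_restriction P.
Proof.
elim/mpoly_ring_ind: P =>
  [k|i|p q [M [a [ha pa]]] [M' [b [hb pb]]]|p q [M [a [ha pa]]] [M' [b [hb pb]]]].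
- exists 0%N, k%:A; split=> [H _|].
    by rewrite mevalC expr0 mul1r; exact: mulr1.
  by rewrite expr0 mul1r /restrict comp_mpolyC /lift_poly mmapC.
- case/mxvec_indexP: i => i j.
  have rE : restrict 'X_(mxvec_index i j) = generic_slice i j.
    by rewrite /restrict comp_mpolyXU -tnth_nth tnth_mktuple mxvecE.
  rewrite /lifts_restriction rE /generic_slice mxE.
  case: eqP => ij.
    have jm : (j < m)%N by have := ltn_ord i; lia.
    rewrite insubT /= /lift_poly mmapC.
    (* x_j times the square of [lead_prod]: cancel G_j in one factor and G_(j+2)
       in the other, as x_j G_j G_(j+2) = G_(j+1)^2 *)
    pose b : B := lead_tor K m j.+1 ^+ 2 * lead_cofactor K m j * lead_cofactor K m j.+2.
    have bE H : in_HU (val H) -> inv_fun (tor_val b) H =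
        inv_fun F H ^+ 2 * subdiag (val H) (Ordinal jm).
      move=> [hH _].
      rewrite expr2 {1}(@lead_cofactorE _ _ j) ?(@lead_cofactorE _ _ j.+2) //; last by lia.
      have := lead_inv_recE (Ordinal jm) hH => /= e.
      rewrite -[LHS]/(inv_fun (lead_inv K m j.+1) H ^+ 2 *
        inv_fun (tor_val (lead_cofactor K m j)) H *
        inv_fun (tor_val (lead_cofactor K m j.+2)) H).
      by rewrite -e; ring.
    exists 2%N, (tor_val b); split=> [H HH|].
      rewrite bE // mevalXU mxvecE; congr (_ * val H _ _); exact/val_inj.
    have xb : x b = gamma ^+ 2 * tcoord c (Ordinal jm).
      rewrite -(kpoint_slice b (fun=> 0)) bE ?lead_prod_slice ?subdiag_slice //.
      exact: slice_nilp_HU.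
    have -> : pi (tor_val b) = pi (x b)%:A by exact: fibre_pi_phi.
    have -> : (x b)%:A = gamma%:A ^+ 2 * (tcoord c (Ordinal jm))%:A :> A.
      by rewrite xb -[LHS]/(in_alg A _) rmorphM rmorphXn.
    rewrite rmorphM rmorphXn pi_lead_prod.
    by congr (_ * pi (in_alg A (tcoord c _))); exact/val_inj.
  case: insubP => [p _ pE|] /=; last first.
    rewrite -leqNgt => ji; exists 0%N, 0; split=> [H [hH _]|].
      rewrite mevalXU mxvecE hH ?mulr0 //; lia.
    by rewrite /lift_poly mmap0 !raddf0 mulr0.
  rewrite /lift_poly mmapX mmap1U /coord_lift; case: cid => Y [_ [M [a [ha aE]]]] /=.
  exists M, a; split=> [H HH|]; first by rewrite ha // slotK pE mevalXU mxvecE.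
  rewrite aE pi_alg pi_lead_prod; congr (_ * _).
  by rewrite -[_%:A in LHS]/(in_alg A _) !rmorphXn.
- exists (M + M')%N, (F ^+ M' * a + F ^+ M * b); split=> [H HH|].
    rewrite -[LHS]/(inv_fun (F ^+ M') H * inv_fun a H + inv_fun (F ^+ M) H * inv_fun b H).
    by rewrite !inv_funX ha // hb // mevalD exprD; ring.
  rewrite rmorphD !rmorphM !rmorphXn /= pa pb /restrict comp_mpolyD /lift_poly mmapD rmorphD.
  by rewrite exprD mulrDr !mulrA [pi F ^+ M' * _]mulrC.
- exists (M + M')%N, (a * b); split=> [H HH|].
    rewrite -[LHS]/(inv_fun a H * inv_fun b H).
    by rewrite ha // hb // mevalM exprD; ring.
  rewrite rmorphM /= pa pb /restrict rmorphM /= /lift_poly rmorphM rmorphM exprD.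
  by rewrite mulrACA.
Qed.

(** For an invariant f represented by P, the invariant a of
  [lifts_restriction] is a power of [lead_prod] times f by [inv_eq_HU], and
  [lead_prod] is invertible on the fibre. *)
Lemma pi_lift_slice f : pi (lift_poly (slice_poly f)) = pi f.
Proof.
rewrite /slice_poly; case: cid => P fP /=.
have [M [a [ha pa]]] := lifts_restriction_all P.
have aE : a = F ^+ M * f.
  apply: inv_eq_HU => H HH; rewrite ha // -fP.
  by rewrite -[RHS]/(inv_fun (F ^+ M) H * inv_fun f H) inv_funX.
have inv : pi (gamma ^- M)%:A * pi F ^+ M = 1.
  have e : (gamma ^- M)%:A * gamma%:A ^+ M = 1 :> A.
    rewrite -[(gamma ^- M)%:A]/(in_alg A _) -[gamma%:A]/(in_alg A _).
    by rewrite -[X in _ * X]rmorphXn -[LHS]rmorphM mulVf ?rmorph1 // expf_neq0 // gamma_neq0.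
  by move/(congr1 pi): e; rewrite rmorphM rmorphXn rmorph1 pi_lead_prod.
rewrite -[LHS]mul1r -inv -mulrA -pa aE rmorphM rmorphXn mulrA inv mul1r.
by [].
Qed.

(** Restriction to the slice and [lift_poly] are mutually inverse. *)
Lemma fibre_iso : fibre_iso_affine_space (tor_incl K m.+1) x D.
Proof.
pose psi (u : Q) : {mpoly K[D]} := slice_poly (repr u).
have psiE f : psi (pi f) = slice_poly f.
  by apply: slice_poly_ideal; rewrite fibre_piK.
have slice_ev f y : (psi (pi f)).@[y] = inv_fun f (slice_nilp y).
  by rewrite psiE slice_polyE.
have psiB : zmod_morphism psi.
  elim/fibre_ind => f; elim/fibre_ind => h; rewrite -raddfB.
  by apply: mpoly_eq_eval => y; rewrite mevalB !slice_ev.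
have psiM : monoid_morphism psi.
  split; first by rewrite -(rmorph1 pi); apply: mpoly_eq_eval => y; rewrite slice_ev meval1.
  elim/fibre_ind => f; elim/fibre_ind => h; rewrite -rmorphM.
  by apply: mpoly_eq_eval => y; rewrite mevalM !slice_ev.
pose psi_add := GRing.isZmodMorphism.Build _ _ psi psiB.
pose psi_mul := GRing.isMonoidMorphism.Build _ _ psi psiM.
pose psi_r : {rmorphism Q -> {mpoly K[D]}} := HB.pack psi psi_add psi_mul.
exists psi_r.
  exists (pi \o lift_poly) => [u|p] /=.
    by elim/fibre_ind: u => f; rewrite psiE pi_lift_slice.
  by rewrite -[LHS]/(psi _) psiE slice_lift_poly.
move=> k; rewrite -[LHS]/(psi _); apply: mpoly_eq_eval => y.
by rewrite slice_ev mevalC; exact: mulr1.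
Qed.
End Fibre.

(** * The theorem *)

Theorem lemma6p7 (R : realType) (n : nat) (hn : (2 <= n)%N) :
  (exists act, toric_action (K := R[i]) (n := n) act) /\
  forall act, toric_action (K := R[i]) (n := n) act ->
    [/\ dominant (tor_incl R[i] n),
        forall (t : torus R[i] n) (y : NmodU R[i] n),
          tor_map (spec_map (tact t) y) =
          spec_map (act (root_char t)) (tor_map y),
        exists X' : set (toric_variety R[i] n),
          dense_orbit act X' /\
          exists psi : torus R[i] n.-1 -> toric_variety R[i] n, torus_iso psi X' &
        forall X' : set (toric_variety R[i] n), dense_orbit act X' ->
          forall x', X' x' ->
            fibre_iso_affine_space (tor_incl R[i] n) x' (((n - 1) * (n - 2)) %/ 2)].
Proof.
case: n hn => // m _; split.
  by eexists; exact: toric_action_exists.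
move=> act act_toric; split.
- exact: tor_incl_dominant.
- exact: tor_map_equivariant.
- exists (range (orbit_map act)); split; first exact: orbit_map_dense.
  by exists (orbit_map act); exact: orbit_map_iso.
- move=> X' X'_dense x' X'x'; apply: fibre_iso => k km.
  exact: (dense_orbit_lead_neq0 act_toric X'_dense X'x' km).
Qed.
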